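(* Let $\epsilon>0$ and let $d\ge 3$ be a fixed integer. There exists a constant $C$ such that, if $m=m(n)\le n$ and $m,n\to\infty$, then $$\mathbb{P}\left(\gamma(G,d_H,f)\le C\ \text{ for all } f\in\mathcal{F}_{G,H}\left(m^{\frac12+\frac{2}{d^2}+\epsilon}\right)\right)\to 1,$$ where the probability is taken over pairs $(G,H)\in\mathcal{G}_{n,d}\times\mathcal{G}_{m,d}$ and the limit is taken as $n\to\infty$.
   Context: $\mathcal{G}_{n,d}$ denotes the uniform probability space of simple $d$-regular graphs on the vertex set $[n]=\{1,\dots,n\}$ ($nd$ and $md$ are assumed even); $G$ and $H$ are chosen independently. For a connected graph $H$, $d_H$ is the usual graph distance on $V(H)$ (the event that $H$ is disconnected has probability tending to $0$ and may be counted as failure). For a $d$-regular graph $G$ on $n$ vertices and $f:V(G)\to V(H)$, $\gamma(G,d_H,f)$ is the number satisfying $$\frac{\gamma(G,d_H,f)}{dn}\sum_{u\sim_G v} d_H^2(f(u),f(v))=\frac{1}{n^2}\sum_{u,v\in V(G)}d_H^2(f(u),f(v)),$$ where the first sum is over edges $\{u,v\}$ of $G$ and the second over ordered pairs of vertices; the statement $\gamma(G,d_H,f)\le C$ means that $\frac{1}{n^2}\sum_{u,v\in V(G)}d_H^2(f(u),f(v))\le\frac{C}{dn}\sum_{u\sim_G v} d_H^2(f(u),f(v))$ (so it holds trivially for constant $f$). For $\delta>0$, $\mathcal{F}_{G,H}(\delta)$ is the class of functions $f:V(G)\to V(H)$ such that $|f^{-1}(i)|\le \frac{n}{\delta}$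 for all $i\in V(H)$, where $n=|V(G)|$. *)

(* Defs.v *)
From mathcomp Require Import all_boot all_order all_algebra.
From mathcomp Require Import all_classical all_reals all_analysis.

Set Implicit Arguments.
Unset Strict Implicit.
Unset Printing Implicit Defensive.

Import Order.TTheory GRing.Theory Num.Theory.
Import numFieldNormedType.Exports.

Local Open Scope ring_scope.

(* A labelled simple graph on [V] is encoded by its set of ordered adjacent   *)
(* pairs, required to be symmetric and irreflexive.                           *)
Definition adj (V : finType) (G : {set V * V}) : rel V :=
  fun x y => (x, y) \in G.

Definition simple_graph (V : finType) (G : {set V * V}) : bool :=
  [forall x, ~~ adj G x x] && [forall x, forall y, adj G x y == adj G y x].

Definition regular (V : finType) (d : nat) (G : {set V * V}) : bool :=
  [forall x, #|[set y | adj G x y]| == d].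

Definition regular_graphs (n d : nat) : {set {set 'I_n * 'I_n}} :=
  [set G | simple_graph G && regular d G].

Definition connected_graph (V : finType) (G : {set V * V}) : bool :=
  [forall x, forall y, connect (adj G) x y].

(* Least length of a walk from [x] to [y]. A shortest walk has fewer than     *)
(* [#|V|] steps; the value is the junk [#|V|] when there is no walk at all.   *)
Definition graph_dist (V : finType) (G : {set V * V}) (x y : V) : nat :=
  \big[minn/#|V|]_(k < #|V| |
      [exists p : k.-tuple V, path (adj G) x p && (last x p == y)]) (k : nat).

Lemma graph_dist_le (V : finType) (G : {set V * V}) (x : V) (p : seq V) :
  path (adj G) x p -> (graph_dist G x (last x p) <= size p)%N.
Proof.
move=> Gp; have [q [Gq Uq lastq le_qp]] : exists q, [/\ path (adj G) x q,
    uniq (x :: q), last x q = last x p & (size q <= size p)%N].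
  case/shortenP: Gp => q Gq Uq sub_qp; exists q; split=> //.
  by rewrite uniq_leq_size //; case/andP: Uq.
have ltq : (size q < #|V|)%N by have := max_card [in x :: q]; rewrite (card_uniqP Uq).
apply: leq_trans le_qp; rewrite /graph_dist -minEnat -leEnat.
apply: (@bigmin_le_cond _ _ _ _ (Ordinal ltq)); apply/existsP.
by exists (in_tuple q); rewrite /= Gq lastq eqxx.
Qed.

Lemma graph_dist_path (V : finType) (G : {set V * V}) (x y : V) :
  connect (adj G) x y -> exists p : seq V,
    [/\ path (adj G) x p, last x p = y & size p = graph_dist G x y].
Proof.
move=> /connectP[p Gp ->{y}].
have ltd : (graph_dist G x (last x p) < #|V|)%N.
  case/shortenP: Gp => q Gq Uq _; apply: leq_ltn_trans (graph_dist_le Gq) _.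
  by have := max_card [in x :: q]; rewrite (card_uniqP Uq).
move: ltd; rewrite /graph_dist; set y := last x p.
apply: (big_ind (fun k => (k < #|V|)%N -> exists q : seq V,
    [/\ path (adj G) x q, last x q = y & size q = k])).
- by rewrite ltnn.
- by move=> a b Ka Kb; rewrite /minn; case: ifP.
- by move=> k /existsP[q /andP[Gq /eqP ly]] _; exists q; rewrite size_tuple.
Qed.

(* [gamma_le d G rho f C] is the statement gamma(G, rho, f) <= C. The         *)
(* condition [u < v] makes the right-hand sum range over unordered edges.     *)
Definition gamma_le (R : realType) (n d : nat) (G : {set 'I_n * 'I_n})
    (W : Type) (rho : W -> W -> R) (f : 'I_n -> W) (C : R) : bool :=
  (n%:R ^+ 2)^-1 * (\sum_(u < n) \sum_(v < n) rho (f u) (f v) ^+ 2) <=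
  C / (d%:R * n%:R) *
    (\sum_(u < n) \sum_(v < n | (u < v)%N && adj G u v) rho (f u) (f v) ^+ 2).

Definition small_fibers (R : realType) (n m : nat) (delta : R)
    (f : 'I_n -> 'I_m) : bool :=
  [forall i : 'I_m, #|[set u | f u == i]|%:R <= n%:R / delta].

(* Disconnected [H], for which the distance is not defined, counts as failure. *)
Definition good_pair (R : realType) (n m d : nat) (delta C : R)
    (GH : {set 'I_n * 'I_n} * {set 'I_m * 'I_m}) : bool :=
  connected_graph GH.2 &&
  [forall f : {ffun 'I_n -> 'I_m}, small_fibers delta f ==>
     gamma_le d GH.1 (fun i j => (graph_dist GH.2 i j)%:R) f C].

Definition uniform_prob_of (R : realType) (T : finType) (A : {set T})
    (E : pred T) : R :=
  #|[set x in A | E x]|%:R / #|A|%:R.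

Definition prob_regular_pair (R : realType) (n m d : nat)
    (E : pred ({set 'I_n * 'I_n} * {set 'I_m * 'I_m})) : R :=
  uniform_prob_of R (finset.setX (regular_graphs n d) (regular_graphs m d)) E.

(* Main.v *)
Require Import Defs.
From mathcomp Require Import all_boot all_order all_algebra.
From mathcomp Require Import all_classical all_reals all_analysis.
From mathcomp Require Import zify ring lra.

Set Implicit Arguments.
Unset Strict Implicit.
Unset Printing Implicit Defensive.

Import Order.TTheory GRing.Theory Num.Theory.
Import numFieldNormedType.Exports.

(** The left-hand side of the inequality is at most the squared diameter of [H],
which is of order [log^2 m]. So it suffices that, for every admissible [f], a
fixed fraction of the edges of [G] is sent to pairs at distance at least of
order [log m]; all lengths are measured by [r + 1], where [r] is of order
[log m] with a small constant. The only probabilistic tool is switching: in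
a [d]-regular graph replace two edges [ab], [ce] by [bc], [ea], and compare by
double counting the families of graphs before and after.

Edges of [G]. Removing the edges of a prescribed set of [k] edges one at a time
shows that this set is contained in a uniform [d]-regular graph on [n] vertices
with probability at most [(c / n)^k] ([contain_bound]), as long as [k] leaves a
positive fraction of the edges free. For fixed [f] and [H] the pairs [uv] with
[f u] and [f v] at distance at most [r] number at most [n^2 (d+1)^r / delta],
because the fibres have size at most [n / delta]. So a proportion [25/26] of the
edges of [G] is of this kind with probability at most
[(c (d+1)^r / delta)^k], with [k] about [(25/26) nd/2]. There are at most [m^n]
maps [f]. As [delta^k] is at least [m^(25n/24)], the union bound over [f] leaves
[m^(-n/24)] up to a factor [(c (d+1)^(rd))^n], which a small [r] makes harmless
([collapsing_whp]). The exponent enters through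
[(1/2 + 2/d^2) d >= 13/6] for [d >= 3], and [(25/52) (13/6) = 25/24].

Diameter of [H]. A set [S] of [s] vertices with fewer than [s/2] boundary edges
spans more than [5s/4] edges; by the bound for prescribed edge sets and a union
over [S], with high probability no set of at most a small proportion [1/kappa]
of the vertices is of this kind ([low_cut_bound]). This bound is too weak for larger sets, where
the number of sets is exponential. There one only needs connectedness: comparing
graphs with [2j] and [2j + 2] edges between [S] and its complement, for all [j],
shows that no edge crosses with probability essentially at most
[1 / C(md/2, sd/2)], which beats the number [C(m, s)] of sets because
[d > 2] ([isolated_bound], [isolated_sets]). Given both properties, a ball whose
radius is a large multiple of [log m] has more than [m / (2 kappa)] vertices;
disjoint such balls can be placed along a geodesic, so only boundedly many fit
and the diameter is of order [log m] ([small_diameter], [diameter_whp]). *)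

(** * Counting and arithmetic *)

(** The engine of every switching argument: [phi u] performs the switching [u] on
an object, [P H] lists the switchings available at [H], and [Q H'] those that
may have led to [H']. Since a switching can be undone, the pairs counted
over [A] inject into those counted over [B]. *)
Lemma double_count (T U : finType) (A B : {set T}) (P Q : T -> pred U)
    (phi : U -> T -> T) (a b : nat) :
  (forall u, injective (phi u)) ->
  (forall H u, H \in A -> P H u -> (phi u H \in B) && Q (phi u H) u) ->
  (forall H, H \in A -> a <= #|P H|) ->
  (forall H, H \in B -> #|Q H| <= b) ->
  #|A| * a <= #|B| * b.
Proof.
move=> phi_inj phiAB geP leQ.
have sumE (C : {set T}) (S : T -> pred U) :
    \sum_(H in C) #|S H| = #|[set p : T * U | (p.1 \in C) && S p.1 p.2]|.
  rewrite -sum1dep_card -(pair_big_dep (mem C) S (fun _ _ => 1)) /=.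
  by apply: eq_bigr => H _; rewrite -sum1_card.
have lePQ : \sum_(H in A) #|P H| <= \sum_(H in B) #|Q H|.
  have psi_inj : injective (fun p : T * U => (phi p.2 p.1, p.2)).
    by move=> [H u] [H' u'] /= [+ eqU]; rewrite eqU => /phi_inj ->.
  rewrite !sumE -(card_imset _ psi_inj); apply/subset_leq_card/fintype.subsetP => q.
  case/imsetP => -[H u]; rewrite !inE /= => /andP[HA HP] -> /=.
  exact: phiAB.
rewrite -!sum_nat_const; apply: leq_trans (leq_trans _ lePQ) _.
  exact: leq_sum.
exact: leq_sum.
Qed.

Lemma union_bound (T I : finType) (A : {set T}) (P : pred I) (E : I -> {set T}) :
  (forall x, x \in A -> exists2 i, P i & x \in E i) ->
  #|A| <= \sum_(i | P i) #|E i|.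
Proof.
move=> AE; rewrite -sum1_card.
have -> : \sum_(i | P i) #|E i| = \sum_(i | P i) \sum_(x in E i) 1.
  by apply: eq_bigr => i _; rewrite sum1_card.
rewrite (exchange_big_dep predT) //= big_mkcond /=; apply: leq_sum => x _.
case: ifP => // /AE[i Pi xE]; rewrite sum1dep_card card_gt0.
by apply/set0Pn; exists i; rewrite inE Pi.
Qed.

Lemma card_exchange (T : finType) (A : {set T}) p q :
  p \in A -> q \notin A -> #|q |: (A :\ p)| = #|A|.
Proof.
move=> pA qA; rewrite cardsU1 !inE (negbTE qA) andbF /=.
by rewrite (cardsD1 p A) pA.
Qed.

Lemma bin_le_exp2 n k : 'C(n, k) <= 2 ^ n.
Proof.
elim: n k => [|n IH] [|k]; rewrite ?bin0 ?expn_gt0 //.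
by rewrite binS expnS mul2n -addnn leq_add.
Qed.

(** One term of the Vandermonde convolution. *)
Lemma bin_supermul x y x' y' :
  'C(x, y) * 'C(x', y') <= 'C(x + x', y + y').
Proof.
rewrite -binomial.Vandermonde.
rewrite (bigD1 (inord y : 'I_(y + y').+1)) //= inordK ?ltnS ?leq_addr // addKn.
exact: leq_addr.
Qed.

(** A crude form of Stirling's bound: the left side is at most the falling
factorial [(2k)(2k-1)...(k+1)], which is [C(2k, k) k!]. *)
Lemma expnn_le_fact k : k ^ k <= 4 ^ k * k`!.
Proof.
apply: (@leq_trans ((2 * k) ^_ k)); last first.
  by rewrite -bin_ffact leq_mul2r -[4]/(2 ^ 2) -expnM bin_le_exp2 orbT.
rewrite ffact_prod -[X in _ ^ X]card_ord -prod_nat_const.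
by apply: leq_prod => i _; have := ltn_ord i; lia.
Qed.

Lemma ffact_le_expn n k : n ^_ k <= n ^ k.
Proof.
rewrite ffact_prod -[X in _ ^ X]card_ord -prod_nat_const.
by apply: leq_prod => i _; apply: leq_subr.
Qed.

(** The first two terms of the binomial expansion of the right-hand side. *)
Lemma double_expnn n : 0 < n -> 2 * n ^ n <= n.+1 ^ n.
Proof.
case: n => // n _; rewrite -[n.+2]addn1 expnDn.
rewrite big_ord_recl big_ord_recl /= bin0 bin1 !exp1n subn0 !muln1 mul1n subn1 /=.
by rewrite -expnS mul2n -addnn addnA leq_addr.
Qed.

(** The sum of [2^-s] over [s >= 1] is at most [1]. *)
Lemma sum_geometric (n : nat) (F : nat -> nat) (a : nat) :
  (forall s, 0 < s <= n -> F s * 2 ^ s <= a) -> \sum_(1 <= s < n.+1) F s <= a.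
Proof.
move=> Fa; rewrite -(@leq_pmul2l (2 ^ n)) ?expn_gt0 //.
suff : 2 ^ n * (\sum_(1 <= s < n.+1) F s) + a <= 2 ^ n * a.
  by apply: leq_trans; apply: leq_addr.
elim: n Fa => [|n IH] Fa; first by rewrite big_nil muln0 mul1n.
rewrite big_nat_recr //= mulnDr expnS -!mulnA.
have {}IH : 2 ^ n * (\sum_(1 <= s < n.+1) F s) + a <= 2 ^ n * a.
  by apply: IH => s /andP[s0 sn]; apply: Fa; rewrite s0 ltnW.
have := Fa n.+1; rewrite leqnn expnS => /(_ isT).
by move: (2 ^ n * (\sum_(1 <= s < n.+1) F s)) (2 ^ n) IH => x y; lia.
Qed.

(** * Switchings of regular graphs *)

Section Switching.
Variable V : finType.
Implicit Types (G H : {set V * V}) (S : {set V}).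

Definition nbr H x : {set V} := [set y | adj H x y].

(** The analogue of [regular_graphs] for an arbitrary vertex type. *)
Definition reg_graphs d : {set {set V * V}} :=
  [set H | simple_graph H && regular d H].

Lemma reg_graphsP d H : reflect
  [/\ forall x, adj H x x = false, forall x y, adj H x y = adj H y x
    & forall x, #|nbr H x| = d] (H \in reg_graphs d).
Proof.
rewrite inE; apply: (iffP andP) => [[/andP[irr sym] reg]|[irr sym reg]]; split.
- by move=> x; apply: negbTE; move/forallP: irr.
- by move=> x y; move/forallP: sym => /(_ x) /forallP /(_ y) /eqP.
- by move=> x; move/forallP: reg => /(_ x) /eqP.
- apply/andP; split; apply/forallP => x; first by rewrite irr.
  by apply/forallP => y; rewrite sym.
by apply/forallP => x; rewrite -[X in X == _]/(#|nbr H x|) reg.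
Qed.

Definition cycle4 (a b c e : V) (x y : V) : bool :=
  [|| (x == a) && (y == b), (x == b) && (y == a), (x == b) && (y == c),
      (x == c) && (y == b), (x == c) && (y == e), (x == e) && (y == c),
      (x == e) && (y == a) | (x == a) && (y == e)].

(** The switching is a symmetric difference with a 4-cycle, which makes it an
involution on all graphs; it preserves degrees when the edges of the cycle
alternate between present and absent. *)
Definition switch (a b c e : V) H : {set V * V} :=
  [set p | adj H p.1 p.2 (+) cycle4 a b c e p.1 p.2].

Lemma adj_switch a b c e H x y :
  adj (switch a b c e H) x y = adj H x y (+) cycle4 a b c e x y.
Proof. by rewrite {1}/adj inE. Qed.

Lemma switchK a b c e : involutive (switch a b c e).
Proof.
move=> H; apply/setP => -[x y]; rewrite inE /= adj_switch.
by rewrite -addbA addbb addbF.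
Qed.

Lemma nbr_switch a b c e H x :
  uniq [:: a; b; c; e] -> nbr (switch a b c e H) x =
  [set y | adj H x y (+) (if x == a then (y == b) || (y == e)
     else if x == b then (y == a) || (y == c)
     else if x == c then (y == b) || (y == e)
     else (x == e) && ((y == a) || (y == c)))].
Proof.
move=> Ud; apply/setP=> y; rewrite !inE adj_switch /cycle4; congr (_ (+) _).
move: Ud; rewrite /= !inE !negb_or !andbT => /and3P[/and3P[ab ac ae] /andP[bc be] ce].
have neqs := (negbTE ab, negbTE ac, negbTE ae, negbTE bc, negbTE be, negbTE ce).
case: (eqVneq x a) => [->|xa]; first by rewrite !neqs /= ?orbF.
case: (eqVneq x b) => [->|xb]; first by rewrite !neqs /= ?orbF.
case: (eqVneq x c) => [->|xc]; first by rewrite !neqs /= ?orbF.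
by rewrite /= ?orbF; case: (x == e); rewrite /= ?orbF // orbC.
Qed.

Lemma switch_regular d a b c e H :
  uniq [:: a; b; c; e] -> adj H a b -> ~~ adj H b c -> adj H c e ->
  ~~ adj H e a -> H \in reg_graphs d -> switch a b c e H \in reg_graphs d.
Proof.
move=> Ud ab bc ce ea /reg_graphsP[irr sym reg]; apply/reg_graphsP; split.
- move=> x; rewrite adj_switch irr /= /cycle4.
  move: Ud; rewrite /= !inE !negb_or !andbT => /and3P[/and3P[aNb aNc aNe] /andP[bNc bNe] cNe].
  have neqs := (negbTE aNb, negbTE aNc, negbTE aNe, negbTE bNc, negbTE bNe, negbTE cNe).
  case: (eqVneq x a) => [->|xa]; first by rewrite !neqs.
  case: (eqVneq x b) => [->|xb]; first by rewrite !neqs.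
  by case: (eqVneq x c) => [->|xc]; rewrite ?neqs //= andbF.
- move=> x y; rewrite !adj_switch sym; congr (_ (+) _); rewrite /cycle4.
  do ![case: (_ == _) => //=].
have sw x p q : adj H x p -> ~~ adj H x q -> forall b1 b2 : pred V,
    (forall y, b1 y (+) b2 y = adj H x y (+) ((y == p) || (y == q))) ->
  #|[set y | b1 y (+) b2 y]| = d.
  move=> xp xq b1 b2 E; rewrite -(reg x) -(@card_exchange _ (nbr H x) p q) ?inE//.
  apply: eq_card => y; rewrite !inE E.
  case: (eqVneq y q) => [->|yq]; first by rewrite (negbTE xq) orbT.
  by case: (eqVneq y p) => [->|yp]; rewrite ?xp //= ?addbF.
move=> x; rewrite nbr_switch //.
case: (eqVneq x a) => [->|xa].
  by apply: (@sw a b e); rewrite // sym.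
case: (eqVneq x b) => [->|xb].
  by apply: (@sw b a c); rewrite // sym.
case: (eqVneq x c) => [->|xc].
  by apply: (@sw c e b) => [//||y]; [rewrite sym | rewrite orbC].
case: (eqVneq x e) => [->|xe] /=.
  by apply: (@sw e c a) => [|//|y]; [rewrite sym | rewrite orbC].
by rewrite -(reg x); apply: eq_card => y; rewrite !inE addbF.
Qed.

End Switching.

(** * Random regular graphs contain a given edge set with small probability *)

Section Contain.
Variable V : finType.
Implicit Types (G H F B : {set V * V}) (S : {set V}).

Definition flip (p : V * V) := (p.2, p.1).

Lemma flipK : involutive flip. Proof. by case. Qed.

Lemma mem_flip F p : (p \in flip @: F) = (flip p \in F).
Proof. by rewrite -{1}[p]flipK (mem_imset _ _ (inv_inj flipK)). Qed.

Lemma card_out d H S : H \in reg_graphs V d ->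
  #|[set p in H | p.1 \in S]| = #|S| * d.
Proof.
move=> /reg_graphsP[_ _ reg].
have -> : #|S| * d = \sum_(x in S) \sum_(y in nbr H x) 1.
  by rewrite -sum_nat_const; apply: eq_bigr => x _; rewrite sum1_card reg.
rewrite pair_big_dep /= sum1dep_card.
by apply: eq_card => -[x y]; rewrite !inE /= andbC.
Qed.

Lemma card_in d H S : H \in reg_graphs V d ->
  #|[set p in H | p.2 \in S]| = #|S| * d.
Proof.
move=> HR; rewrite -(card_out S HR) -(card_imset _ (inv_inj flipK)).
apply: eq_card => -[x y]; by rewrite mem_flip !inE /=; case/reg_graphsP: HR => _ sym _; congr (_ && _); apply: sym.
Qed.

(** A set of edges is given by choosing one of the two orderings of each edge, so
that its cardinality is the number of edges. *)
Definition oriented F := forall x y, (x, y) \in F -> (y, x) \notin F.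

(** The switching replaces [uv] and another edge [xy] by [vy] and [xu]. At a graph
containing [F] there are at least [q] choices of [(x, y)]: exclude the edges
of [F], in both orientations, and those with [x] in the closed neighbourhood of
[u] or [y] in that of [v]. Afterwards [x] is a neighbour of [u] and [y] one of
[v], so at most [d^2] choices lead to the same graph. *)
Lemma contain_step d F u v q :
  oriented F -> (u, v) \in F ->
  q + 2 * #|F| + 2 * (d.+1 * d) <= #|V| * d ->
  #|[set H in reg_graphs V d | F \subset H]| * q <=
  #|[set H in reg_graphs V d | F :\ (u, v) \subset H]| * d ^ 2.
Proof.
move=> oF Fuv leq_q.
pose P H (p : V * V) := [&& p \in H, p \notin F, flip p \notin F,
  p.1 \notin u |: nbr H u & p.2 \notin v |: nbr H v].
pose Q H (p : V * V) := adj H u p.1 && adj H v p.2.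
apply: (@double_count _ _ _ _ P Q (fun p => switch u v p.2 p.1)).
- by move=> p; apply: inv_inj; apply: switchK.
- move=> H [x y] /[!inE] /andP[HR /fintype.subsetP FH] /and5P[/= Hxy nFxy nFyx + +].
  have HRg : H \in reg_graphs V d by rewrite inE.
  have /reg_graphsP[irr sym reg] := HRg.
  rewrite !inE !negb_or => /andP[xNu nHux] /andP[yNv nHvy].
  have Huv : adj H u v by apply: FH.
  have uNv : u != v by apply: contraTneq Huv => ->; rewrite irr.
  have xNv : x != v by apply: contraNneq nHux => ->.
  have yNu : y != u by apply: contraNneq nHvy => ->; rewrite sym.
  have yNx : y != x by apply: contraTneq Hxy => ->; rewrite -[_ \in _]/(adj H x x) irr.
  have Ud : uniq [:: u; v; y; x].
    by rewrite /= !inE !negb_or uNv [u == y]eq_sym yNu [u == x]eq_sym xNu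
       [v == y]eq_sym yNv [v == x]eq_sym xNv yNx.
  have := @switch_regular _ d u v y x H Ud Huv nHvy.
  rewrite [adj H y x]sym [adj H x u]sym => /(_ Hxy nHux HRg).
  rewrite inE => -> /=; apply/andP; split.
    apply/fintype.subsetP => -[a b] /[!inE] /andP[abN Fab] /=.
    rewrite [adj H a b](FH (a, b) Fab) /=; apply/negP; rewrite /cycle4.
    have nF w z : ~~ adj H w z -> (w, z) \notin F by apply: contra; apply: FH.
    repeat case/orP; case/andP => /eqP E1 /eqP E2; move: Fab; apply/negP; rewrite E1 E2.
    - by rewrite E1 E2 eqxx in abN.
    - exact: oF.
    - exact: nF.
    - by apply: nF; rewrite sym.
    - exact: nFyx.
    - exact: nFxy.
    - by apply: nF; rewrite sym.
    - exact: nF.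
  rewrite /Q /= !adj_switch (negbTE nHux) (negbTE nHvy) /cycle4 !eqxx /=.
  by rewrite !orbT.
- move=> H /[!inE] /andP[HR _].
  have HRg : H \in reg_graphs V d by rewrite inE.
  have /reg_graphsP[irr sym reg] := HRg.
  have cH : #|H| = #|V| * d.
    by rewrite -cardsT -(card_out _ HRg); apply: eq_card => p; rewrite !inE andbT.
  have cU w : #|w |: nbr H w| = d.+1 by rewrite cardsU1 reg inE irr.
  have /subset_leq_card : H \subset [set p | P H p] :|: (F :|: (flip @: F :|:
     ([set p in H | p.1 \in u |: nbr H u] :|: [set p in H | p.2 \in v |: nbr H v]))).
    apply/fintype.subsetP => p Hp.
    rewrite !inE mem_flip /P !inE Hp /=.
    move: (p \in F) (flip p \in F) => b1 b2.
    by move: (_ || adj H u p.1) (_ || adj H v p.2) => b3 b4; case: b1 b2 b3 b4 => [] [] [] [].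
  have E1 := card_out (u |: nbr H u) HRg; have E2 := card_in (v |: nbr H v) HRg.
  rewrite cH; move: E1 E2; rewrite !cU.
  set X1 := [set p in H | _]; set X2 := [set p in H | p.2 \in _] => E1 E2.
  have cP : #|[set p | P H p]| = #|P H| by apply: eq_card => p; rewrite inE.
  have l1 := (leq_card_setU X1 X2).1.
  have l2 := (leq_card_setU (flip @: F) (X1 :|: X2)).1.
  have l3 := (leq_card_setU F (flip @: F :|: (X1 :|: X2))).1.
  have l4 := (leq_card_setU [set p | P H p] (F :|: (flip @: F :|: (X1 :|: X2)))).1.
  have l5 := leq_imset_card flip F.
  move: leq_q l1 l2 l3 l4 l5; rewrite E1 E2 cP => {E1 E2 cP cU}.
  by do ![move: #|_|] => *; lia.
- move=> H /[!inE] /andP[HR _].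
  have /reg_graphsP[irr sym reg] : H \in reg_graphs V d by rewrite inE.
  rewrite -(reg u) -mulnn {2}(reg u) -{1}(reg v) -cardsX.
  by apply: subset_leq_card; apply/fintype.subsetP => -[x y]; rewrite !inE.
Qed.

(** The edges of [F] are removed one at a time; each costs a factor [d^2 / q]. *)
Lemma contain_bound d F q :
  oriented F -> q + 2 * #|F| + 2 * (d.+1 * d) <= #|V| * d ->
  #|[set H in reg_graphs V d | F \subset H]| * q ^ #|F| <=
  #|reg_graphs V d| * (d ^ 2) ^ #|F|.
Proof.
elim: {F}_.+1 {-2}F (ltnSn #|F|) => // k IH F ltFk oF leq_q.
have [->|[[u v] Fuv]] := set_0Vmem F.
  rewrite cards0 !expn0 !muln1; apply/subset_leq_card/fintype.subsetP => H.
  by rewrite inE => /andP[].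
have cF := cardsD1 (u, v) F; rewrite Fuv add1n in cF.
have oF' : oriented (F :\ (u, v)).
  move=> x y /[!inE] /andP[_ /oF]; apply: contra => /andP[_ //].
have := contain_step oF Fuv leq_q.
have /IH : #|F :\ (u, v)| < k by rewrite -ltnS -cF.
rewrite cF in leq_q; move=> /(_ oF'); rewrite cF !(expnS q) !(expnS (d ^ 2)).
set X := #|[set _ in _ | _]|; set Y := #|[set _ in _ | F \subset _]|.
set k1 := #|F :\ _|; set Z := #|reg_graphs _ _| => IH' le1; have {}IH' : X * q ^ k1 <= Z * (d ^ 2) ^ k1.
    by apply: IH'; apply: leq_trans leq_q; rewrite leq_add2r leq_add2l leq_mul2l leqnSn orbT.
rewrite mulnA; apply: leq_trans (leq_mul le1 (leqnn _)) _.
by rewrite mulnAC [leqRHS]mulnCA mulnC leq_mul2l IH' orbT.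
Qed.

(** Union bound over the [k]-element subsets of [B]. *)
Lemma many_edges d B k q :
  oriented B -> q + 2 * k + 2 * (d.+1 * d) <= #|V| * d ->
  #|[set H in reg_graphs V d | k <= #|H :&: B|]| * (q ^ k * k`!) <=
  #|reg_graphs V d| * (#|B| * d ^ 2) ^ k.
Proof.
move=> oB leq_q.
have le1 : #|[set H in reg_graphs V d | k <= #|H :&: B|]| <=
    \sum_(F : {set V * V} | (F \subset B) && (#|F| == k))
      #|[set H in reg_graphs V d | F \subset H]|.
  apply: union_bound => H /[!inE] /andP[HR].
  rewrite -bin_gt0 -cards_draws card_gt0 => /set0Pn[F].
  rewrite inE finset.subsetI => /andP[/andP[FH FB] cF].
  by exists F; rewrite ?FB ?cF // !inE HR FH.
apply: leq_trans (leq_mul le1 (leqnn _)) _.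
rewrite big_distrl /=.
apply: (@leq_trans (\sum_(F : {set V * V} | (F \subset B) && (#|F| == k))
   (#|reg_graphs V d| * (d ^ 2) ^ k * k`!))).
  apply: leq_sum => F /andP[FB /eqP cF].
  rewrite mulnA leq_mul2r; apply/orP; right; rewrite -cF; apply: contain_bound; rewrite ?cF //.
  by move=> x y /(fintype.subsetP FB)/oB; apply: contra => /(fintype.subsetP FB).
rewrite sum_nat_const -(eq_card (fun F => finset.in_set _ F)) cards_draws.
rewrite mulnC -!mulnA leq_mul2l; apply/orP; right.
rewrite expnMn mulnC leq_mul2r mulnC bin_ffact; apply/orP; right.
elim: k {leq_q le1} #|B| => [|k IH] b; first by rewrite ffactn0.
rewrite ffactnS expnS leq_mul2l; apply/orP; right.
apply: leq_trans (IH _) _; case: k {IH} => [//|k]; by rewrite leq_exp2r // leq_pred.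
Qed.

End Contain.

(** * Cuts *)

Section Cut.
Variable V : finType.
Implicit Types (G H F B : {set V * V}) (S : {set V}).

Definition cutset H S := [set p in H | (p.1 \in S) && (p.2 \notin S)].
Definition cut H S := #|cutset H S|.
(** Edges inside [S] appear here in both orientations. *)
Definition inner H S := [set p in H | (p.1 \in S) && (p.2 \in S)].

Lemma card_inner d H S : H \in reg_graphs V d ->
  #|inner H S| + cut H S = #|S| * d.
Proof.
move=> HR; rewrite -(card_out S HR) -(cardsID [set p | p.2 \in S] [set p in H | p.1 \in S]).
congr (_ + _); apply: eq_card => p; rewrite !inE ?andbA //.
by rewrite andbC andbA.
Qed.

Lemma cutC d H S : H \in reg_graphs V d -> cut H (~: S) = cut H S.
Proof.
case/reg_graphsP => _ sym _.
rewrite /cut -(card_imset _ (inv_inj (@flipK V))); apply: eq_card => -[x y].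
by rewrite mem_flip !inE negbK /= -[(y, x) \in H]/(adj H y x) sym andbCA andbC andbA.
Qed.

Definition with_cut d S t := [set H in reg_graphs V d | cut H S == t].

(** An edge [xx'] inside [S] and an edge [yy'] outside are replaced by the crossing
edges [xy] and [x'y']. The term [2 d^2] accounts for the [yy'] for which one of
these is already present; in the other direction one chooses an ordered pair
of distinct crossing edges. *)
Lemma cut_step d S t :
  #|with_cut d S t| * ((#|S| * d - t) * (#|~: S| * d - t - 2 * d ^ 2)) <=
  #|with_cut d S t.+2| * (t.+2 * t.+1).
Proof.
pose P H (u : (V * V) * (V * V)) := [&& u.1 \in inner H S, u.2 \in inner H (~: S),
   ~~ adj H u.1.1 u.2.1 & ~~ adj H u.1.2 u.2.2].
pose Q H (u : (V * V) * (V * V)) := [&& (u.1.1, u.2.1) \in cutset H S,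
   (u.1.2, u.2.2) \in cutset H S & (u.1.2, u.2.2) != (u.1.1, u.2.1)].
apply: (@double_count _ _ _ _ P Q (fun u => switch u.1.1 u.1.2 u.2.2 u.2.1)).
- by move=> u; apply: inv_inj; apply: switchK.
- move=> H [[x x'] [y y']] /[!inE] /andP[HR /eqP cH].
  have HRg : H \in reg_graphs V d by rewrite inE.
  have /reg_graphsP[irr sym reg] := HRg.
  rewrite /P !inE /= => /and4P[/and3P[Hx xS x'S] /and3P[Hy yS y'S] nHxy nHxy'].
  have neqS a b : a \in S -> b \notin S -> a != b by move=> aS; apply: contraNneq => <-.
  have neqH a b : (a, b) \in H -> a != b.
    by apply: contraTneq => ->; rewrite -[_ \in _]/(adj H b b) irr.
  have Ud : uniq [:: x; x'; y'; y].
    rewrite /= !inE !negb_or (neqH _ _ Hx) (neqS _ _ xS y'S) (neqS _ _ xS yS).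
    by rewrite (neqS _ _ x'S y'S) (neqS _ _ x'S yS) eq_sym (neqH _ _ Hy).
  have := @switch_regular _ d x x' y' y H Ud Hx nHxy'.
  rewrite [adj H y' y]sym [adj H y x]sym => /(_ Hy nHxy HRg).
  rewrite inE => -> /=.
  have cutE : cutset (switch x x' y' y H) S = (x, y) |: ((x', y') |: cutset H S).
    apply/setP => -[a b]; rewrite !inE /= !xpair_eqE.
    have neqF w z : w \in S -> z \notin S -> ((w == z) = false) * ((z == w) = false).
      by move=> wS zS; split; [|rewrite eq_sym]; apply/negbTE/neqS.
    have [aS|aS] /= := boolP (a \in S); last first.
      by rewrite !andbF (neqF _ _ xS aS) (neqF _ _ x'S aS).
    have [bS|bS] /= := boolP (b \in S).
      by rewrite !andbF (neqF _ _ bS yS) (neqF _ _ bS y'S) !andbF.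
    rewrite !andbT /cycle4 (neqF _ _ xS bS) (neqF _ _ x'S bS) (neqF _ _ aS yS).
    rewrite (neqF _ _ aS y'S) !andbF /= ?orbF.
    have [/andP[/eqP -> /eqP ->]|] := boolP ((a == x) && (b == y)).
      by rewrite (negbTE nHxy) orbT.
    have [/andP[/eqP -> /eqP ->]|] := boolP ((a == x') && (b == y')).
      by rewrite (negbTE nHxy').
    by rewrite addbF.
  have xxN : (x, y) != (x', y') by rewrite xpair_eqE (negbTE (neqH _ _ Hx)).
  have nC a b : ~~ adj H a b -> (a, b) \notin cutset H S.
    by rewrite inE => /negbTE nab; rewrite [_ \in H]nab.
  have cC : #|(x, y) |: ((x', y') |: cutset H S)| = t.+2.
    by rewrite !cardsU1 in_setU1 negb_or xxN !nC //= [#|_|]cH.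
  rewrite /cut cutE cC eqxx /= /Q /= cutE !inE !eqxx /= ?orbT /=.
  by rewrite eq_sym.
- move=> H /[!inE] /andP[HR /eqP cH].
  have HRg : H \in reg_graphs V d by rewrite inE.
  have /reg_graphsP[irr sym reg] := HRg.
  have <- : #|inner H S| = #|S| * d - t by rewrite -(card_inner S HRg) cH addnK.
  have eqI : #|inner H (~: S)| = #|~: S| * d - t.
    by rewrite -(card_inner (~: S) HRg) (cutC S HRg) cH addnK.
  have -> : #|P H| = \sum_(p in inner H S)
      #|[set r in inner H (~: S) | ~~ adj H p.1 r.1 && ~~ adj H p.2 r.2]|.
    under eq_bigr do rewrite -sum1_card.
    rewrite pair_big_dep /= sum1dep_card.
    apply: eq_card => -[p r]; rewrite inE -[LHS]/(P H (p, r)) /P !inE /= !andbA.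
    by [].
  rewrite -sum_nat_const; apply: leq_sum => p _; rewrite -eqI.
  have /subset_leq_card : inner H (~: S) \subset
      [set r in inner H (~: S) | ~~ adj H p.1 r.1 && ~~ adj H p.2 r.2] :|:
      ([set r in H | r.1 \in nbr H p.1] :|: [set r in H | r.2 \in nbr H p.2]).
    apply/fintype.subsetP => r rI; have Hr : r \in H by move: rI; rewrite inE => /andP[].
    rewrite !inE in rI *; rewrite rI Hr /=.
    by move: (adj H p.1 r.1) (adj H p.2 r.2) => [] [].
  have := card_out (nbr H p.1) HRg; have := card_in (nbr H p.2) HRg; rewrite !reg.
  set X1 := [set r in H | _ \in nbr H p.2]; set X2 := [set r in H | _].
  set X := [set r in inner _ _ | _] => c1 c2 l1.
  have l2 := (leq_card_setU X2 X1).1.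
  have l3 := (leq_card_setU X (X2 :|: X1)).1.
  move: l1 l2 l3; rewrite c1 c2 -mulnn.
  by do ![move: #|_|] => *; lia.
- move=> H /[!inE] /andP[HR /eqP cH].
  have h_inj : injective (fun u : (V * V) * (V * V) => ((u.1.1, u.2.1), (u.1.2, u.2.2))).
    by move=> [[? ?] [? ?]] [[? ?] [? ?]] [-> -> -> ->].
  have <- : \sum_(e in cutset H S) #|cutset H S :\ e| = t.+2 * t.+1.
    rewrite -[X in X * _]cH -sum_nat_const; apply: eq_bigr => e eC.
    have := cardsD1 e (cutset H S); rewrite eC [#|cutset H S|]cH; lia.
  under eq_bigr do rewrite -sum1_card.
  rewrite pair_big_dep /= sum1dep_card -(fintype.card_image h_inj (Q H)).
  apply/subset_leq_card/fintype.subsetP => _ /fintype.imageP[u uQ ->].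
  have {uQ} : Q H u := uQ; rewrite /Q !inE /= => /and3P[-> -> uN].
  by rewrite uN.
Qed.

End Cut.

Section Isolated.
Variable V : finType.
Implicit Types (G H F : {set V * V}) (S : {set V}).

(** Iteration of [cut_step] from no crossing edge. The numbers of choices
[2A - 2j] and [2B - 2j] multiply to falling factorials, because the error term
[2 d^2] of each step is a constant that can be absorbed in [B]. *)
Lemma cut_chain d S A B J :
  2 * A <= #|S| * d -> 2 * (B + d ^ 2) <= #|~: S| * d ->
  #|with_cut d S 0| * (4 ^ J * (A ^_ J * B ^_ J)) <=
  #|with_cut d S (2 * J)| * (2 * J)`!.
Proof.
move=> leA leB; elim: J => [|J IH]; first by rewrite !ffactn0 expn0 !muln1.
have := cut_step d S (2 * J); have -> : (2 * J).+2 = 2 * J.+1 by lia.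
set W := #|with_cut d S 0| in IH *; set W1 := #|with_cut d S (2 * J)| in IH *.
set W2 := #|with_cut d S (2 * J.+1)| => step.
have -> : (2 * J.+1)`! = (2 * J.+1) * (2 * J).+1 * (2 * J)`!.
  have -> : 2 * J.+1 = (2 * J).+2 by lia.
  by rewrite !factS mulnA.
rewrite !ffactnSr expnS.
have -> : W * (4 * 4 ^ J * (A ^_ J * (A - J) * (B ^_ J * (B - J)))) =
  W * (4 ^ J * (A ^_ J * B ^_ J)) * ((2 * A - 2 * J) * (2 * B - 2 * J)).
  by rewrite -!mulnBr; ring.
apply: leq_trans (leq_mul IH (leqnn _)) _.
rewrite mulnAC [W2 * _]mulnA leq_mul2r; apply/orP; right.
apply: leq_trans step; rewrite leq_mul2l; apply/orP; right.
by apply: leq_mul; lia.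
Qed.

(** For each [J] the chain gives a bound by [1 / (C(A, J) C(B, J))]; summing these
over [J] collects [C(A + B, A)] by Vandermonde's convolution, so that the best
[J] need not be located. *)
Lemma isolated_bound d S A B :
  2 * A <= #|S| * d -> 2 * (B + d ^ 2) <= #|~: S| * d ->
  #|with_cut d S 0| * 'C(A + B, A) <= #|reg_graphs V d| * A.+1.
Proof.
move=> leA leB; rewrite addnC -binomial.Vandermonde big_distrr /=.
rewrite -[A.+1 in leqRHS]card_ord mulnC -sum_nat_const; apply: leq_sum => J _.
have leJA : J <= A by rewrite -ltnS.
rewrite bin_sub // [_ * 'C(A, J)]mulnC.
have := cut_chain J leA leB.
have leW : #|with_cut d S (2 * J)| <= #|reg_graphs V d|.
  by apply/subset_leq_card/fintype.subsetP => H; rewrite inE => /andP[].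
move=> /leq_trans /(_ (leq_mul leW (leqnn _))).
have fE : (2 * J)`! = 'C(2 * J, J) * (J`! * J`!).
  by rewrite -(@bin_fact (2 * J) J) //; [congr (_ * (_ * _`!)) | ]; lia.
have b4 : 'C(2 * J, J) <= 4 ^ J by rewrite -[4]/(2 ^ 2) -expnM bin_le_exp2.
rewrite -!bin_ffact fE.
set W := #|with_cut d S 0|; set Z := #|reg_graphs V d|; set a := 'C(A, J); set b := 'C(B, J).
have -> : W * (4 ^ J * (a * J`! * (b * J`!))) = 4 ^ J * (J`! * J`!) * (W * (a * b)) by ring.
move=> le1; have f0 : 0 < 4 ^ J * (J`! * J`!) by rewrite !muln_gt0 expn_gt0 fact_gt0.
rewrite -(leq_pmul2l f0); apply: leq_trans le1 _; rewrite mulnC leq_mul2r.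
by apply/orP; right; rewrite leq_mul2r b4 orbT.
Qed.

(** With [A] about [sd/2] and [A + B] about [md/2], [C(A + B, A)] exceeds the number
[C(m, s)] of sets by the factor [C(X', Y)] of order at least [s^4], as [d > 2].
Polynomial decay is all that is used. *)
Lemma isolated_sets d s : 3 <= d -> 0 < s -> 2 * s <= #|V| ->
  4 * d ^ 2 + 18 <= #|V| ->
  #|[set H in reg_graphs V d | [exists S : {set V}, (#|S| == s) && (cut H S == 0)]]|
    * s ^ 3 <= #|reg_graphs V d| * (384 * d).
Proof.
move=> d3 s0 s2 Vd; set X := #|_|; set m := #|V| in s2 Vd *.
(* Rounding down avoids any case distinction on the parity of [s d]. *)
pose A := (s * d) %/ 2; pose B := ((m - s) * d) %/ 2 - d ^ 2.
have sd : s * 3 <= s * d by rewrite leq_mul2l d3 orbT.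
have msd : (m - s) * 3 <= (m - s) * d by rewrite leq_mul2l d3 orbT.
pose Y := A - s; pose X' := B + A - m.
have AY : A = s + Y by rewrite /Y /A; lia.
have BX : A + B = m + X' by rewrite /X' /B /A; lia.
have XY : Y + 4 <= X' by rewrite /Y /X' /B /A; lia.
have sY : s <= 2 * Y.+1 by rewrite /Y /A; lia.
have le1 : X <= \sum_(S : {set V} | #|S| == s) #|with_cut d S 0|.
  apply: union_bound => H; rewrite finset.in_set => /andP[HR /existsP[S /andP[cS HS]]].
  by exists S => //; rewrite finset.in_set HR.
have le2 : X * 'C(A + B, A) <= 'C(m, s) * (#|reg_graphs V d| * A.+1).
  apply: leq_trans (leq_mul le1 (leqnn _)) _; rewrite big_distrl /=.
  rewrite -card_draws -sum_nat_const.
  rewrite [leqRHS](eq_bigl (fun S : {set V} => #|S| == s)); last by move=> S; rewrite inE.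
  apply: leq_sum => S /eqP cS; apply: isolated_bound; rewrite ?cS.
    by rewrite /A; lia.
  by rewrite cardsCs finset.setCK cS -/m /B; lia.
have le3 : 'C(m, s) * 'C(X', Y) <= 'C(A + B, A) by rewrite BX AY bin_supermul.
have le4 : Y.+1 ^ 4 <= 24 * 'C(X', Y).
  apply: (@leq_trans (24 * 'C(Y + 4, Y))); last by rewrite leq_mul2l leq_bin2l.
  rewrite -bin_sub ?leq_addr // addKn -[24]/(4`!) mulnC bin_ffact.
  rewrite !expnS !ffactnS expn0 ffactn0 muln1; by do 3![apply: leq_mul; first by lia]; lia.
have C0 : 0 < 'C(m, s) by rewrite bin_gt0; lia.
have le5 : X * 'C(X', Y) <= #|reg_graphs V d| * A.+1.
  rewrite -(leq_pmul2l C0) mulnCA; apply: leq_trans le2.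
  by rewrite leq_mul2l le3 orbT.
have le6 : X * Y.+1 ^ 4 <= 24 * (#|reg_graphs V d| * A.+1).
  apply: leq_trans (leq_mul (leqnn X) le4) _.
  by rewrite mulnCA leq_mul2l le5 orbT.
have le7 : s ^ 4 <= 16 * Y.+1 ^ 4 by rewrite -[16]/(2 ^ 4) -expnMn leq_exp2r.
rewrite -(leq_pmul2r s0) -mulnA -expnSr.
apply: leq_trans (leq_mul (leqnn X) le7) _; rewrite mulnCA.
apply: leq_trans (leq_mul (leqnn 16) le6) _.
have -> : 16 * (24 * (#|reg_graphs V d| * A.+1)) = #|reg_graphs V d| * 384 * A.+1 by ring.
rewrite [384 * d]mulnC mulnA [_ * d * 384]mulnAC -!mulnA !leq_mul2l /=.
by rewrite [d * s]mulnC /A; apply/orP; right; lia.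
Qed.

End Isolated.

(** * Small sets have large boundary *)

Section Small.
Variable V : finType.
Implicit Types (G H F B : {set V * V}) (S : {set V}).

(** The pairs of vertices of [S], in the orientation given by the enumeration of the
vertices. *)
Definition inside S : {set V * V} :=
  [set p | [&& p.1 \in S, p.2 \in S & enum_rank p.1 < enum_rank p.2]].

Lemma inside_oriented S : oriented (inside S).
Proof. by move=> x y; rewrite !inE /= => /and3P[-> -> /ltnW]; rewrite leqNgt. Qed.

Lemma card_inside S : #|inside S| <= #|S| ^ 2.
Proof.
rewrite -mulnn -cardsX; apply/subset_leq_card/fintype.subsetP => p.
by rewrite !inE => /and3P[-> ->].
Qed.

Lemma inner_inside d H S : H \in reg_graphs V d ->
  #|inner H S| = 2 * #|H :&: inside S|.
Proof.
case/reg_graphsP => irr sym _.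
have flip_inj := inv_inj (@flipK V).
rewrite mul2n -addnn -[X in _ = _ + X](card_imset _ flip_inj) -cardsUI.
rewrite (_ : H :&: _ :&: _ = finset.set0) ?cards0 ?addn0; last first.
  apply/setP => p; rewrite inE mem_flip !inE /=.
  by case: ltngtP; rewrite ?andbF.
apply: eq_card => -[x y]; rewrite inE finset.in_setU mem_flip !inE /=.
rewrite -[(x, y) \in H]/(adj H x y) -[(y, x) \in H]/(adj H y x) [adj H y x]sym.
have [xS|xS] := boolP (x \in S); rewrite ?andbF //.
have [yS|yS] := boolP (y \in S); rewrite ?andbF //=.
rewrite -andb_orr -neq_ltn andbC; case: eqVneq => [/val_inj/enum_rank_inj ->|_]; last by rewrite andbT.
by rewrite irr.
Qed.

Definition low_cut d s := [set H in reg_graphs V d |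
  [exists S : {set V}, (#|S| == s) && (2 * cut H S < s)]].

(** The degrees in [S] sum to [sd], so a boundary below [s/2] forces more than
[(3s - s/2) / 2 = 5s/4] edges inside [S]. *)
Lemma low_cut_count d s k q : 3 <= d -> 4 * k <= 5 * s + 4 ->
  q + 2 * k + 2 * (d.+1 * d) <= #|V| * d ->
  #|low_cut d s| * (q ^ k * k`!) <=
    'C(#|V|, s) * (#|reg_graphs V d| * (s ^ 2 * d ^ 2) ^ k).
Proof.
move=> d3 ks leq_q.
have le1 : #|low_cut d s| <= \sum_(S : {set V} | #|S| == s)
    #|[set H in reg_graphs V d | k <= #|H :&: inside S|]|.
  apply: union_bound => H; rewrite finset.in_set => /andP[HR /existsP[S /andP[cS HS]]].
  exists S => //; rewrite finset.in_set HR /=; have := card_inner S HR.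
  rewrite (eqP cS) (inner_inside S HR).
  have sd : s * 3 <= s * d by rewrite leq_mul2l d3 orbT.
  by move: #|_| (cut H S) sd HS => *; lia.
apply: leq_trans (leq_mul le1 (leqnn _)) _; rewrite big_distrl /=.
rewrite -card_draws -sum_nat_const.
rewrite [leqRHS](eq_bigl (fun S : {set V} => #|S| == s)); last by move=> S; rewrite inE.
apply: leq_sum => S /eqP cS; apply: leq_trans (many_edges (@inside_oriented S) leq_q) _.
rewrite leq_mul2l; apply/orP; right; case: k {ks leq_q le1} => // k.
by rewrite leq_exp2r // leq_mul2r -cS card_inside orbT.
Qed.

(** There are about [(m/s)^s] sets, and each has low cut with probability of order
[(s/m)^(s+j)] with [j > s/4]. One of the [j] surplus factors gives the
decay in [m]; the others, small because [s / m] is, compensate all factors that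
are exponential in [s] and leave [2^-s] for the summation over [s]. *)
Lemma low_cut_bound d s : 3 <= d -> 0 < s -> 4 * (d.+1 * d) <= #|V| ->
  let c := 4 * d ^ 2 in
  c * s * (16 * c) ^ 4 <= #|V| ->
  #|low_cut d s| * (#|V| * 2 ^ s) <= #|reg_graphs V d| * (c * (16 * c) ^ 4).
Proof.
move=> d3 s0 md c; set W := 16 * c => ms.
set m := #|V| in md ms *; set X := #|low_cut d s|; set N := #|reg_graphs V d|.
have c36 : 36 <= c by rewrite /c -[36]/(4 * 3 ^ 2) leq_mul2l leq_exp2r.
have W1 : 1 < W by rewrite /W; lia.
have W40 : 0 < W ^ 4 by rewrite expn_gt0; lia.
have s36 : 36 * s <= m.
  by apply: leq_trans ms; rewrite -[leqLHS]muln1; apply: leq_mul => //; rewrite leq_mul2r c36 orbT.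
have m0 : 0 < m by lia.
pose j := (s %/ 4).+1.
have js : s < 4 * j by rewrite /j; lia.
have ks : 4 * (s + j) <= 5 * s + 4 by rewrite /j; lia.
have md3 : m * 3 <= m * d by rewrite leq_mul2l d3 orbT.
have leq_q : m + 2 * (s + j) + 2 * (d.+1 * d) <= m * d by lia.
have := low_cut_count d3 ks leq_q; rewrite -/X -/N -/m => le1.
have le2 : 'C(m, s) * s ^ s <= 4 ^ s * m ^ s.
  rewrite mulnC; apply: leq_trans (leq_mul (expnn_le_fact s) (leqnn _)) _.
  by rewrite -mulnA leq_mul2l [_`! * _]mulnC bin_ffact ffact_le_expn orbT.
have le3 : s ^ (s + j) <= 4 ^ (s + j) * (s + j)`!.
  by apply: leq_trans (expnn_le_fact _); rewrite leq_exp2r ?leq_addr // addn_gt0 s0.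
(* The union bound, with factorials replaced by powers and common powers of
   [s] and [m] cancelled. *)
have le4 : X * m ^ j <= N * (4 * c) ^ s * (c * s) ^ j.
  have p0 : 0 < m ^ s * (s ^ s * s ^ (s + j)) by rewrite !muln_gt0 !expn_gt0 m0 s0.
  rewrite -(leq_pmul2l p0).
  apply: (@leq_trans (X * (m ^ (s + j) * (4 ^ (s + j) * (s + j)`!)) * s ^ s)).
    rewrite [leqLHS](_ : _ = X * m ^ (s + j) * s ^ (s + j) * s ^ s); last by rewrite !expnD; ring.
    rewrite leq_mul2r [X * (_ * _)]mulnA; apply/orP; right.
    exact: leq_mul.
  apply: (@leq_trans (4 ^ (s + j) * s ^ s * ('C(m, s) * (N * (s ^ 2 * d ^ 2) ^ (s + j))))).
    rewrite [leqLHS](_ : _ = 4 ^ (s + j) * s ^ s * (X * (m ^ (s + j) * (s + j)`!))).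
      by rewrite leq_mul2l le1 orbT.
    by rewrite !expnD; ring.
  rewrite [leqLHS](_ : _ = ('C(m, s) * s ^ s) * (4 ^ (s + j) * (N * (s ^ 2 * d ^ 2) ^ (s + j)))).
    apply: leq_trans (leq_mul le2 (leqnn _)) _.
    by apply: eq_leq; rewrite /c -!mulnn !expnMn !expnD; ring.
  by ring.
have [i jE] : exists i, j = i.+1 by exists (s %/ 4).
(* Of the factors [c s / m], one is kept and the other [j - 1] are at most
   [W^-4]. *)
have le5 : X * m * W ^ (4 * j) <= N * (4 * c) ^ s * (c * s) * W ^ 4.
  have p0 : 0 < m ^ i by rewrite expn_gt0 m0.
  rewrite -(leq_pmul2l p0) [leqLHS](_ : _ = X * m ^ j * (W ^ 4) ^ i * W ^ 4); last first.
    by rewrite jE (expnS m) expnM (expnS (W ^ 4)); ring.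
  rewrite [leqRHS](_ : _ = N * (4 * c) ^ s * (c * s) * m ^ i * W ^ 4); last by ring.
  rewrite leq_mul2r; apply/orP; right.
  apply: leq_trans (leq_mul le4 (leqnn _)) _.
  rewrite jE (expnS (c * s)) -!mulnA !leq_mul2l; do !(apply/orP; right).
  rewrite -expnMn; case: (i) => // i'; rewrite leq_exp2r //.
  by apply: leq_trans ms; apply: eq_leq; rewrite /c; ring.
(* [4 j > s], and [W = 4 (4 c)] beats the factor [(4 c)^s]. *)
have le6 : X * m * W ^ s <= N * (4 * c) ^ s * (c * s) * W ^ 4.
  by apply: leq_trans le5; rewrite leq_mul2l leq_exp2l // ltnW ?orbT.
have s2 : s <= 2 ^ s by apply/ltnW/ltn_expl.
have c0 : 0 < c by exact: leq_trans c36.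
have p0 : 0 < (4 * c) ^ s * 2 ^ s by rewrite muln_gt0 !expn_gt0 (leq_mul (ltn0Sn 3) c0).
rewrite -(leq_pmul2l p0).
rewrite [leqLHS](_ : _ = X * m * W ^ s); last first.
  rewrite /W (_ : 16 * c = 4 * c * (2 * 2)); last by ring.
  by rewrite [(4 * c * _) ^ s]expnMn [(2 * 2) ^ s]expnMn; ring.
apply: leq_trans le6 _.
rewrite [leqRHS](_ : _ = N * (4 * c) ^ s * (c * 2 ^ s) * W ^ 4); last by ring.
by rewrite leq_mul2r leq_mul2l leq_mul2l s2 !orbT.
Qed.

End Small.

(** * Balls and the diameter *)

Section Balls.
Variable V : finType.
Implicit Types (G H F : {set V * V}) (S : {set V}).

Definition nbhd H S := S :|: \bigcup_(x in S) nbr H x.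
Definition gball H x r := iter r (nbhd H) [set x].

Lemma gballP H x r y : reflect
  (exists p : seq V, [/\ path (adj H) x p, last x p = y & size p <= r])
  (y \in gball H x r).
Proof.
apply: (iffP idP).
  elim: r y => [|r IH] y; first by rewrite inE => /eqP ->; exists [::].
  rewrite finset.in_setU => /orP[/IH[p [Hp lp sp]]|/bigcupP[z /IH[p [Hp lp sp]]]].
    by exists p; split=> //; apply: leqW.
  rewrite inE => zy; exists (rcons p y).
  by rewrite rcons_path last_rcons size_rcons lp zy Hp.
case=> p [Hp <- sp] {y}; elim: r p Hp sp => [|r IH] p.
  by case: p => //= _ _; rewrite inE.
case/lastP: p => [_ _|p y]; first by rewrite finset.in_setU (IH [::]).
rewrite rcons_path last_rcons size_rcons ltnS => /andP[Hp py] sp.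
rewrite finset.in_setU; apply/orP; right; apply/bigcupP; exists (last x p); rewrite ?inE //.
exact: IH.
Qed.

Lemma gball_dist H x y r : y \in gball H x r -> graph_dist H x y <= r.
Proof. by case/gballP => p [Hp <-]; apply/leq_trans/graph_dist_le. Qed.

Lemma dist_gball H x y r :
  connect (adj H) x y -> graph_dist H x y <= r -> y \in gball H x r.
Proof. by case/graph_dist_path => p [Hp lp <-] sp; apply/gballP; exists p. Qed.

Lemma gball_trans H x y z i j :
  y \in gball H x i -> z \in gball H y j -> z \in gball H x (i + j).
Proof.
case/gballP => p [Hp lp sp] /gballP[q [Hq lq sq]]; apply/gballP; exists (p ++ q).
by rewrite cat_path last_cat size_cat lp Hp Hq leq_add.
Qed.

Lemma gball_mono H x i j : i <= j -> gball H x i \subset gball H x j.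
Proof.
move=> ij; apply/fintype.subsetP => y /gballP[p [Hp lp sp]]; apply/gballP; exists p.
by split=> //; apply: leq_trans ij.
Qed.

Lemma gball_sym d H x y r :
  H \in reg_graphs V d -> y \in gball H x r -> x \in gball H y r.
Proof.
case/reg_graphsP => _ sym _ /gballP[p [Hp <- sp]]; apply/gballP.
exists (rev (belast x p)); split.
- by rewrite rev_path (eq_path (e' := adj H)).
- by case: p {Hp sp} => //= z p; rewrite rev_cons last_rcons.
- by rewrite size_rev size_belast.
Qed.

Lemma card_gball d H x r : H \in reg_graphs V d -> #|gball H x r| <= d.+1 ^ r.
Proof.
move=> /reg_graphsP[_ _ reg]; elim: r => [|r IH]; first by rewrite cards1.
rewrite expnSr; apply: leq_trans (leq_mul IH (leqnn _)).
rewrite /gball iterS -/(gball H x r) /nbhd; apply: leq_trans (leq_card_setU _ _).1 _.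
rewrite mulnS leq_add2l -sum_nat_const.
apply: (big_rec2 (fun (A : {set V}) k => #|A| <= k)) => [|z A k _ IHA].
  by rewrite cards0.
by apply: leq_trans (leq_card_setU _ _).1 _; rewrite reg leq_add2l.
Qed.

(** A vertex outside [S] receives at most [d] of the boundary edges. *)
Lemma card_nbhd d H S : H \in reg_graphs V d ->
  cut H S + #|S| * d <= #|nbhd H S| * d.
Proof.
move=> HR; have NS : S \subset nbhd H S by apply: finset.subsetUl.
rewrite -(cardsID S (nbhd H S)) (finset.setIidPr NS) addnC mulnDl leq_add2l.
rewrite -(card_in _ HR); apply/subset_leq_card/fintype.subsetP => -[x y].
rewrite !inE /= => /and3P[Hxy xS yS]; rewrite Hxy yS /=.
by apply/orP; right; apply/bigcupP; exists x; rewrite ?inE.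
Qed.

(** While a ball has at most [L] vertices it grows by the factor [1 + 1/(2d)] at each
step, so balls of radius [rho] have more than [L] vertices. If the ball of
radius [i + rho] around [x] is not everything, connectedness gives a vertex at
distance [i + rho + 1]; the ball of radius [rho] around it is disjoint from the
ball of radius [i] around [x]. So increasing the radius by [2 rho + 1] adds
more than [L] vertices, which can happen fewer than [K] times. *)
Lemma small_diameter d H L rho K :
  H \in reg_graphs V d ->
  (forall S, 0 < #|S| <= L -> #|S| <= 2 * cut H S) ->
  (forall S, L < #|S| -> 2 * #|S| <= #|V| -> 0 < cut H S) ->
  L * (2 * d) ^ rho < (2 * d).+1 ^ rho ->
  #|V| <= K * L ->
  forall x y, y \in gball H x (K * (2 * rho).+1).
Proof.
move=> HR small medium grow leVK.
(* One of [S] and its complement has at most half of the vertices. *)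
have cut_gt0 S : S != finset.set0 -> S != [set: V] -> 0 < cut H S.
  have half T : T != finset.set0 -> 2 * #|T| <= #|V| -> 0 < cut H T.
    rewrite -card_gt0 => T0; have [leTL _|/medium] := leqP #|T| L; last exact.
    by have := small T; rewrite T0 leTL => /(_ isT); case: cut => //; lia.
  have [|ltV] := leqP (2 * #|S|) #|V|; first by move=> le S0 _; apply: half.
  move=> _ ST; rewrite -(cutC S HR); apply: half.
    by rewrite -(inj_eq (@finset.setC_inj V)) finset.setCK finset.setC0.
  by rewrite [in leqLHS]cardsCs finset.setCK; have := max_card (mem S); lia.
have big_ball x : L < #|gball H x rho|.
  rewrite ltnNge; apply/negP => le_L.
  have : (2 * d).+1 ^ rho <= (2 * d) ^ rho * #|gball H x rho|.
    have le_i i : i <= rho -> #|gball H x i| <= L.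
      by move=> /(gball_mono H x)/subset_leq_card/leq_trans; apply.
    elim: {-2}rho (leqnn rho) => [|i IH] lt_i; first by rewrite cards1 !expn0.
    have {}IH := IH (ltnW lt_i); rewrite expnS.
    apply: leq_trans (leq_mul (leqnn _) IH) _.
    rewrite mulnCA expnSr -mulnA leq_mul2l; apply/orP; right.
    have := card_nbhd (gball H x i) HR; have := small (gball H x i).
    rewrite (le_i i (ltnW lt_i)) andbT -/(gball H x i.+1) card_gt0.
    have /[swap]/[apply] : gball H x i != finset.set0.
      by apply/set0Pn; exists x; apply/gballP; exists [::].
    rewrite -[nbhd _ _]/(gball H x i.+1); move: (cut _ _) #|gball H x i| #|gball H x i.+1|.
    move=> c a b; rewrite [a * d]mulnC [b * d]mulnC [(2 * d).+1 * a]mulSn -!mulnA; move: (d * a) (d * b) => *; lia.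
  by apply/negP; rewrite -ltnNge; apply: leq_trans grow; rewrite ltnS mulnC leq_mul2r le_L orbT.
move=> x y.
have : (gball H x (K * (2 * rho).+1) == [set: V]) || (K * L.+1 <= #|gball H x (K * (2 * rho).+1)|).
  elim: (K) => [|k /orP[/eqP allT|IH]]; first by rewrite mul0n orbT.
    apply/orP; left; rewrite -finset.subTset -allT; apply: gball_mono.
    by rewrite leq_mul2r leqnSn orbT.
  set i := k * (2 * rho).+1 in IH; have -> : k.+1 * (2 * rho).+1 = i + rho + 1 + rho by rewrite /i; lia.
  have [allT|notT] := eqVneq (gball H x (i + rho)) [set: V].
    apply/orP; left; rewrite -finset.subTset -allT; apply: gball_mono; lia.
  have n0 : gball H x (i + rho) != finset.set0.
    by apply/set0Pn; exists x; apply/gballP; exists [::].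
  have := cut_gt0 _ n0 notT; rewrite card_gt0 => /set0Pn[[u v]].
  rewrite !inE /= => /and3P[Huv uB vB].
  have vB1 : v \in gball H x (i + rho + 1).
    by apply: gball_trans uB _; apply/gballP; exists [:: v]; rewrite /= andbT.
  apply/orP; right; rewrite mulSn addnC; apply: leq_trans (leq_add IH (big_ball v)) _.
  rewrite -cardsUI (_ : _ :&: _ = finset.set0) ?cards0 ?addn0.
    apply/subset_leq_card; rewrite finset.subUset gball_mono /=; last by rewrite -!addnA leq_addr.
    by apply/fintype.subsetP => z zv; apply: gball_trans zv.
  apply/setP => z; rewrite !inE; apply/andP => -[zx zv]; case/negP: vB.
  by apply: gball_trans zx _; apply: (gball_sym HR).
case/orP => [/eqP -> //|le1].
have K0 : 0 < K.
  by apply: contraTT leVK; rewrite -leqNgt leqn0 => /eqP ->; rewrite -ltnNge; apply/card_gt0P; exists x.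
have := max_card (mem (gball H x (K * (2 * rho).+1))).
by move/(leq_trans le1)/leq_trans/(_ leVK); rewrite leq_pmul2l // ltnn.
Qed.

End Balls.

(** As [(1 + 1/(2d))^(2d) >= 2], the radius [2dM] multiplies balls by at least
[2^M >= M]. *)
Lemma growth d M m r rho : 0 < d -> m < M ^ r.+1 -> rho = 2 * d * M * r.+1 ->
  m * (2 * d) ^ rho < (2 * d).+1 ^ rho.
Proof.
move=> d0 mM rhoE; have dd : 0 < 2 * d by rewrite muln_gt0.
apply: (@leq_trans (M ^ r.+1 * (2 * d) ^ rho)).
  by rewrite ltn_pmul2r // expn_gt0 dd.
rewrite rhoE !(expnM _ _ r.+1) -expnMn leq_exp2r //.
rewrite !(expnM _ (2 * d) M).
apply: (@leq_trans ((2 * (2 * d) ^ (2 * d)) ^ M)).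
  by rewrite [leqRHS]expnMn leq_mul2r ltnW ?orbT // ltn_expl.
by case: M {mM rhoE} => // M; rewrite leq_exp2r // double_expnn.
Qed.

(** Sets of at most [|V| / kap] vertices are covered by [low_cut_bound], those up to
half of the vertices by [isolated_sets]. Taking [M] large makes the unit
of length [trunc_log M |V|] as small a multiple of [log |V|] as needed. *)
Lemma diameter_whp d M : 3 <= d -> 1 < M -> exists D C m0 : nat,
  forall V : finType, m0 <= #|V| ->
  #|[set H in reg_graphs V d | ~~ [forall x, forall y,
       y \in gball H x (D * (trunc_log M #|V|).+1)]]| * #|V| <=
  C * #|reg_graphs V d|.
Proof.
move=> d3 M1; pose c := 4 * d ^ 2; pose kap := c * (16 * c) ^ 4.
pose t := 2 * d * M.
exists (2 * kap * (2 * t).+1), (kap + 384 * d * kap ^ 3), (kap + 4 * (d.+1 * d) + 4 * d ^ 2 + 18).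
move=> V; set m := #|V| => lem; set r := trunc_log M m.
have c0 : 0 < c by rewrite /c muln_gt0 expn_gt0; case: (d) d3.
have kap0 : 0 < kap by rewrite /kap muln_gt0 expn_gt0 muln_gt0 c0.
have [km m1 m2] : [/\ kap <= m, 4 * (d.+1 * d) <= m & 4 * d ^ 2 + 18 <= m].
  move: lem; rewrite -addnA; move: (4 * (d.+1 * d)) (4 * d ^ 2 + 18) => a b lem.
  split; apply: leq_trans lem; last exact: leq_addl.
    by rewrite -addnA leq_addr.
  by rewrite addnAC leq_addl.
pose L := m %/ kap.
have L1 : 0 < L by rewrite divn_gt0.
have Lm : L * kap <= m by apply: leq_trunc_div.
have mL : m < L.+1 * kap by rewrite ltn_ceil.
pose rho := t * r.+1.
have grow : L * (2 * d) ^ rho < (2 * d).+1 ^ rho.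
  apply: (leq_ltn_trans _ (@growth d M m r rho _ _ _)) => //; last 2 first.
  - by apply: leq_trans d3.
  - exact: trunc_log_ltn.
  - by rewrite leq_mul2r (leq_trans _ Lm) ?orbT // leq_pmulr.
have m2L : m <= 2 * kap * L.
  apply: leq_trans (ltnW mL) _; rewrite mulnAC leq_mul2r.
  by rewrite mul2n -addnn -addn1 leq_add2l L1 orbT.
pose iso s := [set H in reg_graphs V d |
  [exists S : {set V}, (#|S| == s) && (cut H S == 0)]].
set N := #|reg_graphs V d|; set X := #|_|.
(* Failure comes from a set of at most [L] vertices with low cut, or from a
   larger one without outgoing edges. *)
have leX : X <= \sum_(1 <= s < L.+1) #|low_cut V d s| +
    \sum_(s < m.+1 | (L < s) && (2 * s <= m)) #|iso s|.
  rewrite big_add1 /= (big_mkord xpredT (fun s => #|low_cut V d s.+1|)) /=.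
  pose E1 : {set {set V * V}} := \bigcup_(s : 'I_L) low_cut V d s.+1.
  pose E2 : {set {set V * V}} :=
    \bigcup_(s : 'I_m.+1 | (L < s) && (2 * s <= m)) iso s.
  apply: (@leq_trans (#|E1| + #|E2|)); last first.
    apply: leq_add; apply: union_bound => H /bigcupP[s]; first by exists s.
    by move=> sL Hs; exists s.
  rewrite -cardsUI; apply: leq_trans (leq_addr _ _).
  apply/subset_leq_card/fintype.subsetP => H; rewrite finset.in_set => /andP[HR]; apply: contraR.
  rewrite finset.in_setU negb_or => /andP[nE1 nE2].
  apply/forallP => x; apply/forallP => y.
  apply: (fintype.subsetP (gball_mono H x (_ : 2 * kap * (2 * rho).+1 <= _))).
    rewrite -[leqRHS]mulnA leq_mul2l /rho; apply/orP; right.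
    by rewrite [leqRHS]mulSn mulnA -[leqLHS]add1n leq_add2r.
  apply: (small_diameter HR (L := L)) => //.
  - move=> S /andP[S0 SL]; rewrite leqNgt; apply: contra nE1 => lowS.
    have ltS : #|S|.-1 < L by rewrite prednK.
    apply/bigcupP; exists (Ordinal ltS) => //=; rewrite prednK // finset.in_set HR /=.
    by apply/existsP; exists S; rewrite eqxx.
  - move=> S LS Sm; rewrite lt0n; apply: contra nE2 => isoS.
    have ltS : #|S| < m.+1 by rewrite ltnS max_card.
    apply/bigcupP; exists (Ordinal ltS); rewrite /= ?LS // finset.in_set HR /=.
    by apply/existsP; exists S; rewrite eqxx.
apply: leq_trans (leq_mul leX (leqnn m)) _; rewrite mulnDl mulnDl leq_add //.
  rewrite big_distrl /=; apply: sum_geometric => s /andP[s0 sL].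
  rewrite -mulnA [leqRHS]mulnC; apply: low_cut_bound => //; rewrite -/m -/c.
  by rewrite mulnAC mulnC (leq_trans _ Lm) // leq_mul2r sL orbT.
have m0 : 0 < m by apply: leq_trans km.
rewrite -(leq_pmul2r (_ : 0 < m ^ 2)) ?expn_gt0 ?m0 //.
rewrite -mulnA -expnS big_distrl /=.
apply: (@leq_trans (\sum_(s < m.+1 | (L < s) && (2 * s <= m)) N * (384 * d * kap ^ 3))).
  apply: leq_sum => s /andP[Ls sm].
  apply: (@leq_trans (#|iso s| * (s * kap) ^ 3)).
    by rewrite leq_mul2l leq_exp2r // (leq_trans (ltnW mL)) ?orbT // leq_mul2r Ls orbT.
  rewrite expnMn mulnA [N * _]mulnA leq_mul2r; apply/orP; right.
  apply: isolated_sets => //; exact: leq_trans Ls.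
rewrite sum_nat_cond_const [leqRHS](_ : _ = m ^ 2 * (N * (384 * d * kap ^ 3))); last by ring.
rewrite leq_mul2r; apply/orP; right.
apply: (@leq_trans m.+1); last first.
  have m18 : 1 < m by apply: leq_trans m2; rewrite addnC.
  rewrite expnS expn1; apply: (@leq_trans (2 * m)); last by rewrite leq_mul2r m18 orbT.
  by rewrite mul2n -addnn -addn1 leq_add2l.
by rewrite -[X in _ <= X]card_ord; apply: max_card.
Qed.

(** * Existence of regular graphs *)

(** The elements [1, ..., d./2] and their opposites, with the element of order two
added when [d] is odd; it exists as the order of the group is then even. *)
Lemma symmetric_subset n d : d < n.+1 -> ~~ odd (n.+1 * d) ->
  exists T : {set 'I_n.+1}, [/\ #|T| = d, (0%R \notin T)
    & forall x, (- x)%R \in T = (x \in T)].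
Proof.
move=> dn nd; pose h := d./2.
have hn (j : 'I_h) : j.+1 < n.+1 by have := ltn_ord j; rewrite /h; lia.
pose A : {set 'I_n.+1} := [set inord j.+1 | j : 'I_h].
have AP x : x \in A -> 0 < x <= h.
  by case/imsetP => j _ ->; rewrite inordK //= ltn_ord.
have cA : #|A| = h.
  rewrite card_imset ?card_ord // => i j /(congr1 val); rewrite /= !inordK // => -[].
  exact: val_inj.
pose B := [set (- x)%R | x in A].
have BP x : x \in B -> n.+1 - h <= x < n.+1.
  case/imsetP => y /AP y0 ->; rewrite /= modn_small; first by lia.
  by lia.
have cB : #|B| = h by rewrite card_imset ?cA //; apply: oppr_inj.
have AB : [disjoint A & B].
  by rewrite disjoint_subset; apply/fintype.subsetP => x /AP xA; rewrite inE; apply/negP => /BP; lia.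
have cAB : #|A :|: B| = h.*2.
  by rewrite cardsU (disjoint_setI0 AB) cards0 subn0 cA cB addnn.
have mB x : ((- x)%R \in B) = (x \in A) by rewrite mem_imset //; apply: oppr_inj.
have sym x : ((- x)%R \in A :|: B) = (x \in A :|: B).
  by rewrite !finset.in_setU mB -(mB (- x)%R) opprK orbC.
have n0 : 0%R \notin A :|: B.
  by apply/negP; rewrite finset.in_setU => /orP[/AP|/BP] //=; rewrite /h; lia.
have [od|ed] := boolP (odd d); last first.
  by exists (A :|: B); split=> //; rewrite cAB /h; lia.
have en : ~~ odd n.+1 by move: nd; rewrite oddM od andbT.
pose c : 'I_n.+1 := inord (n.+1)./2.
have vc : c = (n.+1)./2 :> nat by rewrite inordK //; lia.
have cN : (- c)%R = c.
  by apply/val_inj => /=; rewrite vc modn_small; lia.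
have cAB' : c \notin A :|: B.
  by apply/negP; rewrite finset.in_setU => /orP[/AP|/BP]; rewrite vc /h; lia.
exists (c |: (A :|: B)); split.
- by rewrite cardsU1 cAB' cAB /h; lia.
- rewrite in_setU1 negb_or n0 andbT; apply/eqP => /(congr1 val) /=.
  by rewrite vc; lia.
- by move=> x; rewrite !in_setU1 sym -{1}cN (inj_eq oppr_inj).
Qed.

(** A Cayley graph of the cyclic group. *)
Lemma reg_graphs_gt0 n d : d < n -> ~~ odd (n * d) -> 0 < #|reg_graphs 'I_n d|.
Proof.
case: n => // n dn /(symmetric_subset dn)[T [cT T0 TN]]; apply/card_gt0P.
exists [set p : 'I_n.+1 * 'I_n.+1 | (p.2 - p.1)%R \in T]; apply/reg_graphsP; split.
- by move=> x; rewrite /adj inE subrr (negbTE T0).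
- by move=> x y; rewrite /adj !inE /= -TN opprB.
move=> x; rewrite -cT -[in RHS](card_imset _ (@addrI _ x)); apply: eq_card => y.
have -> : y = (x + (y - x))%R by rewrite addrC subrK.
move: (y - x)%R => z.
rewrite (mem_imset _ _ (@addrI _ x)) inE /adj inE.
have e : (x + z - x = z)%R by rewrite addrAC subrr add0r.
by rewrite -[in RHS]e.
Qed.

(** * Few edges of the domain are collapsed *)

Local Open Scope ring_scope.

Definition close_pairs n m (H : {set 'I_m * 'I_m}) (f : 'I_n -> 'I_m) r :
    {set 'I_n * 'I_n} :=
  [set p : 'I_n * 'I_n | (p.1 < p.2)%N && (f p.2 \in gball H (f p.1) r)].

Lemma close_pairs_oriented n m H (f : 'I_n -> 'I_m) r :
  oriented (close_pairs H f r).
Proof. by move=> x y; rewrite !inE /= negb_and -leqNgt => /andP[/ltnW ->]. Qed.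

Lemma card_close_pairs (R : realType) n m d H (f : 'I_n -> 'I_m) r (delta : R) :
  H \in reg_graphs 'I_m d -> 0 < delta -> small_fibers delta f ->
  #|close_pairs H f r|%:R <= n%:R ^+ 2 * d.+1%:R ^+ r / delta.
Proof.
move=> HR d0 /forallP small.
have le1 : (#|close_pairs H f r| <=
    \sum_(u < n) \sum_(i in gball H (f u) r) #|[set v | f v == i]|)%N.
  apply: (@leq_trans (\sum_(u < n) #|[set v | f v \in gball H (f u) r]|)).
    under [leqRHS]eq_bigr do rewrite -sum1_card.
    rewrite pair_big_dep /= sum1dep_card; apply/subset_leq_card/fintype.subsetP => p.
    by rewrite !inE => /andP[].
  apply: leq_sum => u _; apply: union_bound => v; rewrite inE => fv.
  by exists (f v); rewrite // inE.
apply: (@le_trans _ _ (\sum_(u < n) \sum_(i in gball H (f u) r) (n%:R / delta))).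
  apply: le_trans (_ : (_ : nat)%:R <= _); first by rewrite ler_nat; exact: le1.
  rewrite natr_sum; apply: ler_sum => u _; rewrite natr_sum; apply: ler_sum => i _.
  exact: small.
have nd0 : 0 <= n%:R / delta by rewrite divr_ge0 // ltW.
apply: (@le_trans _ _ (\sum_(u < n) (d.+1%:R ^+ r * (n%:R / delta)))).
  apply: ler_sum => u _; rewrite sumr_const -[leLHS]mulr_natl ler_wpM2r //.
  by rewrite -natrX ler_nat (card_gball _ _ HR).
by rewrite sumr_const card_ord -[leLHS]mulr_natl expr2 !mulrA [n%:R * _ * n%:R]mulrAC.
Qed.

(** Equivalent, without [eps], to [(3d - 4)(d - 3) >= 0]. *)
Lemma exponent_bound (R : realType) (eps : R) (d : nat) : 0 < eps -> (3 <= d)%N ->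
  13 / 6 <= (2^-1 + 2 / d%:R ^+ 2 + eps) * d%:R.
Proof.
move=> e0 d3; have dR : 3 <= d%:R :> R by rewrite (ler_nat R 3 d).
have d0 : 0 < d%:R :> R by lra.
suff : 13 / 6 <= (2^-1 + 2 / d%:R ^+ 2) * d%:R :> R.
  by move/le_trans; apply; rewrite ler_wpM2r ?lerDl // ltW.
move: (d%:R) dR d0 => x x3 x0.
have -> : (2^-1 + 2 / x ^+ 2) * x = (x ^+ 2 + 4) / (2 * x) by field; lra.
rewrite ler_pdivlMr; last by lra.
have : 0 <= (3 * x - 4) * (x - 3) by apply: mulr_ge0; lra.
lra.
Qed.

(** Just above a proportion [25/26] of the [nd/2] edges. *)
Definition edge_threshold n d := (25 * (n * d) %/ 52).+1.

Definition collapsing (R : realType) n m d (delta : R) (H : {set 'I_m * 'I_m}) r k :=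
  [set G in reg_graphs 'I_n d | [exists f : {ffun 'I_n -> 'I_m},
     small_fibers delta f && (k <= #|G :&: close_pairs H f r|)%N]].

(** Union bound over the at most [m^n] maps, with [many_edges] for [q = nd / 104]
rounded down. The constant comes from [k! >= (k/4)^k], [q >= nd / 208] and
[k >= 25 nd / 52], as [4 * 208 * 52 / 25 <= 4 * 433 = 1732]. *)
Lemma collapsing_bound (R : realType) n m d (delta : R) H r k :
  (0 < d)%N -> (104 * (1 + d.+1 * d) <= n)%N -> 0 < delta -> H \in reg_graphs 'I_m d ->
  k = edge_threshold n d ->
  #|collapsing n d delta H r k|%:R * delta ^+ k <=
  #|reg_graphs 'I_n d|%:R * m%:R ^+ n * (1732 * d.+1%:R ^+ r) ^+ k.
Proof.
move=> dpos n0 d0 HR kE; set X := #|_|; set Ng := #|reg_graphs _ _|.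
set N := (n * d)%N; pose q := (N %/ 104)%N.
have N0 : (104 * (1 + d.+1 * d) <= N)%N by apply: leq_trans n0 _; rewrite leq_pmulr.
rewrite /edge_threshold -/N in kE.
have N0' : (104 <= N)%N by apply: leq_trans N0; rewrite leq_pmulr.
have leq_q : (q + 2 * k + 2 * (d.+1 * d) <= N)%N.
  by rewrite kE /q; move: N0; move: (d.+1 * d)%N (N) => e N1; clear; lia.
have qk : (N ^ 2 <= 433 * (q * k))%N.
  have q1 : (N <= 208 * q)%N by rewrite /q; move: N0'; move: (N) => N1; clear; lia.
  have k1 : (25 * N <= 52 * k)%N by rewrite kE; move: (N) => N1; clear; lia.
  rewrite -(leq_pmul2l (isT : 0 < 25)%N); apply: (@leq_trans (208 * q * (52 * k))).
    by rewrite -mulnn mulnCA leq_mul.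
  by rewrite [leqLHS](_ : _ = 10816 * (q * k))%N ?mulnA; [rewrite leq_mul2r leq_mul2r !orbT | ring].
pose b : R := n%:R ^+ 2 * d.+1%:R ^+ r / delta.
have b0 : 0 <= b by rewrite divr_ge0 ?mulr_ge0 ?exprn_ge0 // ltW.
have bd0 : 0 <= b * d%:R ^+ 2 by apply: mulr_ge0 => //; apply: exprn_ge0.
have le1 : X%:R * (q%:R ^+ k * k`!%:R) <= Ng%:R * m%:R ^+ n * (b * d%:R ^+ 2) ^+ k.
  have le2 : (X <= \sum_(f : {ffun 'I_n -> 'I_m} | small_fibers delta f)
      #|[set G in reg_graphs 'I_n d | k <= #|G :&: close_pairs H f r|]|)%N.
    apply: union_bound => G; rewrite finset.in_set => /andP[GR /existsP[f /andP[sf kf]]].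
    by exists f => //; rewrite finset.in_set GR.
  apply: (@le_trans _ _ (\sum_(f : {ffun 'I_n -> 'I_m} | small_fibers delta f)
      Ng%:R * (b * d%:R ^+ 2) ^+ k)).
    apply: le_trans (_ : (\sum_(f : {ffun 'I_n -> 'I_m} | small_fibers delta f)
      #|[set G in reg_graphs 'I_n d | k <= #|G :&: close_pairs H f r|]|)%N%:R *
        (q%:R ^+ k * k`!%:R) <= _).
      by rewrite ler_wpM2r ?ler_nat // mulr_ge0 ?exprn_ge0.
    rewrite natr_sum mulr_suml; apply: ler_sum => f sf.
    apply: (@le_trans _ _ (Ng * (#|close_pairs H f r| * d ^ 2) ^ k)%N%:R).
      rewrite -natrX -!natrM ler_nat; apply: many_edges => //.
        exact: close_pairs_oriented.
      by rewrite card_ord.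
    rewrite natrM natrX natrM natrX ler_wpM2l //.
    apply: lerXn2r; rewrite ?nnegrE.
    - by rewrite mulr_ge0 ?exprn_ge0.
    - exact: bd0.
    apply: ler_wpM2r; rewrite ?exprn_ge0 //; exact: card_close_pairs.
  rewrite sumr_const -[leLHS]mulr_natr mulrAC ler_wpM2r ?(exprn_ge0 k bd0) //.
  rewrite ler_wpM2l // -natrX ler_nat; apply: leq_trans (max_card _) _.
  by rewrite card_ffun !card_ord.
have le3 : (N ^ (2 * k) <= 1732 ^ k * (q ^ k * k`!))%N.
  rewrite expnM; apply: (@leq_trans ((433 * (q * k)) ^ k)); first by rewrite leq_exp2r // kE.
  rewrite -[1732%N]/(433 * 4)%N !expnMn -!mulnA leq_mul2l mulnCA leq_mul2l.
  by rewrite expnn_le_fact !orbT.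
have N2 : 0 < (N%:R : R) ^+ (2 * k) by rewrite exprn_gt0 // ltr0n; apply: leq_trans N0'.
rewrite -(ler_pM2l N2).
apply: (@le_trans _ _ (1732 ^+ k * delta ^+ k * (X%:R * (q%:R ^+ k * k`!%:R)))).
  rewrite [leRHS](_ : _ = (1732 ^ k * (q ^ k * k`!))%N%:R * (X%:R * delta ^+ k)).
    by rewrite ler_wpM2r ?mulr_ge0 ?exprn_ge0 // ?(ltW d0) // -natrX ler_nat.
  by rewrite !natrM !natrX; ring.
apply: le_trans (ler_wpM2l _ le1) _.
  by apply: mulr_ge0; apply: exprn_ge0; [exact: ler0n | exact: ltW].
move: (1732 : R) => c1.
rewrite le_eqVlt; apply/orP; left; apply/eqP; rewrite /b /N natrM exprM !exprMn -!exprM exprVn.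
have dk0 : delta ^+ k != 0 by rewrite expf_neq0 // gt_eqF.
by field.
Qed.

(** All quantities are compared with powers of [y = m^(1/48)]: there are at most
[y^(48n)] maps, [delta^k] is at least [y^(50n)], and [(d+1)^(rd)] and
[2 * 1732^d] are each at most [y], by the choice of [r] and for [m] large. *)
Lemma collapsing_whp (R : realType) (eps : R) d :
  0 < eps -> (3 <= d)%N -> exists m0 : nat, forall n m H,
  (m0 <= m)%N -> (m <= n)%N -> H \in reg_graphs 'I_m d ->
  (#|collapsing n d (m%:R `^ (2^-1 + 2 / d%:R ^+ 2 + eps) : R) H
       (trunc_log (d.+1 ^ (48 * d)) m) (edge_threshold n d)| * 2 ^ n <=
   #|reg_graphs 'I_n d|)%N.
Proof.
move=> e0 d3; have ex := exponent_bound e0 d3.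
set a := 2^-1 + _ + _ in ex *.
have dpos : (0 < d)%N by apply: leq_trans d3.
have [c1 c1E] : {c1 : nat | c1 = 1732%N} by exists 1732%N.
exists ((2 * c1 ^ d) ^ 48 + 104 * (1 + d.+1 * d))%N => n m H lem mn HR.
have m1 : (0 < m)%N.
  by apply: leq_trans lem; rewrite addn_gt0 orbC muln_gt0.
set r := trunc_log _ _; set k := edge_threshold n d.
have mR : 1 <= m%:R :> R by rewrite ler1n.
have del0 : 0 < m%:R `^ a by rewrite powR_gt0 // ltr0n.
have le104 : (104 * (1 + d.+1 * d) <= n)%N.
  by apply: leq_trans mn; apply: leq_trans lem; apply: leq_addl.
have := @collapsing_bound R n m d _ H r k dpos le104 del0 HR erefl.
set X := #|_|; set Ng := #|reg_graphs _ _|; set delta := _ `^ a; rewrite -c1E => le1.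
pose y : R := m%:R `^ (48%:R^-1).
have y0 : 0 < y by rewrite powR_gt0 // ltr0n.
have y48 : y ^+ 48 = m%:R.
  by rewrite -powR_mulrn ?ltW // -powRrM mulVf ?powRr1 // pnatr_eq0.
have le_y (z : nat) : (z ^ 48 <= m)%N -> z%:R <= y.
  by move=> zm; rewrite -(@ler_pXn2r _ 48) ?nnegrE ?(ltW y0) // y48 -natrX ler_nat.
have yr : d.+1%:R ^+ r ^+ d <= y.
  rewrite -!natrX; apply: le_y; rewrite -!expnM.
  apply: leq_trans (@trunc_logP (d.+1 ^ (48 * d)) m _ m1); last first.
    by rewrite -[ltnLHS](exp1n (48 * d)) ltn_exp2r ?muln_gt0 ?dpos // ltnS.
  by rewrite -expnM -/r; apply: eq_leq; congr (_ ^ _)%N; ring.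
have yc : 2 * c1%:R ^+ d <= y.
  rewrite -natrX -natrM; apply: le_y; apply: leq_trans lem; exact: leq_addr.
have k52 : (25 * (n * d) <= 52 * k)%N.
  by rewrite /k /edge_threshold; move: (n * d)%N => N; clear; lia.
have kn : (k <= d * n)%N.
  rewrite /k /edge_threshold [(n * d)%N]mulnC.
  have : (104 <= d * n)%N.
    by apply: leq_trans (leq_mul dpos le104); rewrite mul1n leq_pmulr.
  by move: (d * n)%N => N; clear; lia.
have delk : y ^+ (50 * n) <= delta ^+ k.
  rewrite /y /delta -[leLHS]powR_mulrn ?powR_ge0 // -[leRHS]powR_mulrn ?powR_ge0 //.
  rewrite -!powRrM; apply: ler_powR; first exact: mR.
  have k52R : 25 * (n%:R * d%:R) <= 52 * k%:R :> R by rewrite -!natrM ler_nat.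
  have n0 : 0 <= n%:R :> R by [].
  have k0 : 0 <= k%:R :> R by [].
  have dR : 0 < d%:R :> R by rewrite ltr0n.
  rewrite -(ler_pM2r dR) natrM.
  have /(ler_wpM2r k0) : 13 / 6 <= a * d%:R := ex.
  rewrite [a * d%:R * _]mulrAC; apply: le_trans.
  rewrite -[48%:R^-1 * _ * _]mulrA [48%:R^-1 * _]mulrC ler_pdivrMr //.
  lra.
have base1 : 1 <= c1%:R * d.+1%:R ^+ r :> R.
  by rewrite -natrX -natrM ler1n muln_gt0 expn_gt0 c1E.
have le2 : X%:R * y ^+ (50 * n) <= Ng%:R * (y ^+ (49 * n) * c1%:R ^+ d ^+ n).
  apply: le_trans (_ : X%:R * delta ^+ k <= _); first by rewrite ler_wpM2l.
  apply: le_trans le1 _; rewrite -mulrA ler_wpM2l //.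
  apply: (@le_trans _ _ (m%:R ^+ n * (c1%:R * d.+1%:R ^+ r) ^+ (d * n))).
    by rewrite ler_wpM2l ?exprn_ge0 // ler_weXn2l.
  rewrite [(_ * _) ^+ (d * n)]exprM [(_ * _) ^+ d]exprMn [(_ * _) ^+ n]exprMn.
  rewrite mulrA mulrAC -y48 -[_ ^+ 48 ^+ n]exprM.
  rewrite ler_wpM2r ?exprn_ge0 // (_ : 49 * n = 48 * n + n)%N; last by ring.
  rewrite [y ^+ (_ + _)]exprD ler_wpM2l ?exprn_ge0 ?(ltW y0) //.
  by apply: lerXn2r; rewrite ?nnegrE ?exprn_ge0 // ltW.
have yn0 : 0 < y ^+ (50 * n) by rewrite exprn_gt0.
rewrite -(ler_nat R) -(ler_pM2r yn0) natrM natrX mulrAC.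
apply: le_trans (ler_wpM2r _ le2) _; first by rewrite exprn_ge0.
rewrite -mulrA ler_wpM2l // (_ : 50 * n = 49 * n + n)%N; last by ring.
rewrite [in leRHS]exprD -mulrA ler_wpM2l ?exprn_ge0 ?(ltW y0) //.
rewrite -exprMn mulrC; apply: lerXn2r; rewrite ?nnegrE ?mulr_ge0 ?exprn_ge0 // ltW //.
Qed.

(** * From distances to the Poincare inequality *)

Lemma card_edges n d (G : {set 'I_n * 'I_n}) : G \in reg_graphs 'I_n d ->
  (2 * #|[set p in G | (p.1 < p.2)%N]| = n * d)%N.
Proof.
move=> GR; have cE : #|[set p in G | (p.1 < p.2)%N]| = #|G :&: inside [set: 'I_n]|.
  by apply: eq_card => p; rewrite !inE /= !enum_rank_ord.
rewrite cE -(inner_inside _ GR) -[in RHS](card_ord n) -cardsT -(card_out _ GR).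
by apply: eq_card => p; rewrite !inE.
Qed.

(** At least [nd/52] edges have length at least [r + 1], while no distance exceeds
[D (r + 1)]. *)
Lemma stretched_gamma (R : realType) n m d D r (G : {set 'I_n * 'I_n})
    (H : {set 'I_m * 'I_m}) (f : 'I_n -> 'I_m) :
  (0 < d)%N -> (0 < n)%N -> G \in reg_graphs 'I_n d ->
  (forall x y, y \in gball H x (D * r.+1)) ->
  (#|G :&: close_pairs H f r| < edge_threshold n d)%N ->
  gamma_le d G (fun i j => (graph_dist H i j)%:R : R) f (52 * D%:R ^+ 2).
Proof.
move=> d0 n0 GR diam few; rewrite /gamma_le.
have N0 : (0 < n * d)%N by rewrite muln_gt0 n0.
set s := \sum_(u < n) \sum_(v < n) _; set t := \sum_(u < n) \sum_(v < n | _) _.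
pose rho : R := r.+1%:R ^+ 2.
have rho0 : 0 <= rho by rewrite exprn_ge0.
have s_le : s <= n%:R ^+ 2 * (D%:R ^+ 2 * rho).
  apply: (@le_trans _ _ (\sum_(u < n) \sum_(v < n) (D%:R ^+ 2 * rho))).
    apply: ler_sum => u _; apply: ler_sum => v _.
    rewrite /rho -exprMn -natrM; apply: lerXn2r; rewrite ?nnegrE // ler_nat.
    exact/gball_dist/diam.
  by rewrite !sumr_const !card_ord -mulrnA -[leLHS]mulr_natl natrM expr2.
pose E := [set p in G | (p.1 < p.2)%N].
have far_le : (n * d <= 52 * #|E :\: close_pairs H f r|)%N.
  have := card_edges GR; rewrite -/E -(cardsID (close_pairs H f r) E).
  have : (#|E :&: close_pairs H f r| <= #|G :&: close_pairs H f r|)%N.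
    by apply/subset_leq_card/finset.setSI/fintype.subsetP => p; rewrite inE => /andP[].
  move: few; rewrite /edge_threshold ltnS.
  move: #|G :&: _| #|E :&: _| #|E :\: _| (n * d)%N => a b c N h1 h2 h3.
  by clear -h1 h2 h3; lia.
have t_ge : #|E :\: close_pairs H f r|%:R * rho <= t.
  rewrite /t pair_big_dep /= mulr_natl -sumr_const.
  rewrite [leRHS](bigID (fun p => p \in close_pairs H f r)) /=.
  apply: ler_wpDl; first by apply: sumr_ge0 => p _; apply: exprn_ge0.
  rewrite [leRHS](eq_bigl (fun p : 'I_n * 'I_n => p \in E :\: close_pairs H f r)); last first.
    move=> [u v]; rewrite !inE /adj /=; case: ((u, v) \in G) => /=; rewrite ?andbF //.
    by rewrite andbT andbC.
  apply: ler_sum => p; rewrite !inE negb_and => /andP[+ /andP[_ lt]].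
  rewrite lt /= => far; apply: lerXn2r; rewrite ?nnegrE // ler_nat ltnNge.
  apply: contra far => /dist_gball; apply.
  by have /gballP[q [Hq <- _]] := diam (f p.1) (f p.2); apply/connectP; exists q.
have nR : 0 < n%:R :> R by rewrite ltr0n.
have dR : 0 < d%:R :> R by rewrite ltr0n.
apply: (@le_trans _ _ (D%:R ^+ 2 * rho)).
  by rewrite mulrC ler_pdivrMr ?exprn_gt0 // mulrC.
apply: (@le_trans _ _ (52 * D%:R ^+ 2 / (d%:R * n%:R) * (#|E :\: close_pairs H f r|%:R * rho))); last first.
  rewrite ler_wpM2l // mulr_ge0 ?invr_ge0 ?mulr_ge0 ?exprn_ge0 ?ler0n // ltW //.
have far_leR : d%:R * n%:R <= 52 * #|E :\: close_pairs H f r|%:R :> R.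
  by rewrite mulrC -!natrM ler_nat.
rewrite [leRHS](_ : _ = D%:R ^+ 2 * rho *
   (52 * #|E :\: close_pairs H f r|%:R / (d%:R * n%:R))); last by field; rewrite !gt_eqF.
by rewrite ler_peMr ?mulr_ge0 ?exprn_ge0 // ler_pdivlMr ?mulr_gt0 // mul1r.
Qed.

(** Failure means that the second component lies in [B'], or that the first is bad
for the second one, which is bounded by conditioning on the second component. *)
Lemma uniform_pair_prob (R : realType) (T U : finType) (A : {set T}) (B B' : {set U})
    (E : pred (T * U)) (bad : U -> {set T}) (alpha beta : R) :
  (0 < #|A|)%N -> (0 < #|B|)%N -> 0 <= alpha ->
  #|B'|%:R <= beta * #|B|%:R ->
  (forall y, y \in B -> #|bad y|%:R <= alpha * #|A|%:R) ->
  (forall x y, x \in A -> y \in B -> ~~ E (x, y) -> y \notin B' -> x \in bad y) ->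
  `|1 - uniform_prob_of R (finset.setX A B) E| <= alpha + beta.
Proof.
move=> A0 B0 alpha0 leB lebad badE; rewrite /uniform_prob_of.
pose good := [set p in finset.setX A B | E p]; pose fail := [set p in finset.setX A B | ~~ E p].
rewrite -[[set x in _ | _]]/good.
have AB0 : 0 < #|A|%:R * #|B|%:R :> R by rewrite mulr_gt0 ?ltr0n.
have sumE : (#|A|%:R * #|B|%:R = #|good|%:R + #|fail|%:R :> R).
  rewrite -natrM -cardsX -natrD -(cardsID [set p | E p] (finset.setX A B)).
  by congr (_ + _)%:R; apply: eq_card => p; rewrite !inE // andbC.
rewrite cardsX natrM.
have -> : 1 - #|good|%:R / (#|A|%:R * #|B|%:R) = #|fail|%:R / (#|A|%:R * #|B|%:R) :> R.
  have -> : #|good|%:R = #|A|%:R * #|B|%:R - #|fail|%:R :> R by rewrite sumE addrK.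
  by field; rewrite !pnatr_eq0 -!lt0n B0.
rewrite ger0_norm; last by rewrite divr_ge0 // ltW.
rewrite ler_pdivrMr //.
have le1 : (#|fail| <= \sum_(y in B) #|bad y| + #|A| * #|B'|)%N.
  have le2 : (#|fail| <= \sum_(y in B) #|finset.setX (bad y) [set y]| + #|finset.setX A B'|)%N.
    pose F := \bigcup_(y in B) finset.setX (bad y) [set y].
    apply: (@leq_trans (#|F| + #|finset.setX A B'|)); last first.
      by rewrite leq_add2r; apply: union_bound => p /bigcupP[y yB py]; exists y.
    rewrite -cardsUI; apply: leq_trans (leq_addr _ _).
    apply/subset_leq_card/fintype.subsetP => -[x y].
    rewrite !inE /= => /andP[/andP[xA yB] nE]; rewrite xA /=.
    have [yB'|yB'] := boolP (y \in B'); first by rewrite orbT.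
    rewrite orbF; apply/bigcupP; exists y => //; rewrite !inE eqxx andbT.
    exact: badE.
  apply: leq_trans le2 _; rewrite cardsX leq_add2r; apply: leq_sum => y _.
  by rewrite cardsX cards1 muln1.
apply: (@le_trans _ _ (\sum_(y in B) #|bad y|%:R + #|A|%:R * #|B'|%:R)).
  by rewrite -natr_sum -natrM -natrD ler_nat.
rewrite mulrDl lerD //.
  apply: (@le_trans _ _ (\sum_(y in B) alpha * #|A|%:R)); first exact: ler_sum.
  by rewrite sumr_const -[leLHS]mulr_natr mulrA.
by rewrite mulrCA ler_wpM2l.
Qed.

Lemma good_pair_prob (R : realType) (eps : R) (d : nat) : 0 < eps -> (3 <= d)%N ->
  exists (C K : R) (m0 : nat), forall n m : nat, (m0 <= m)%N -> (m <= n)%N ->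
    ~~ odd (n * d) -> ~~ odd (m * d) ->
    `|1 - @prob_regular_pair R n m d
       (good_pair d (m%:R `^ (2^-1 + 2 / d%:R ^+ 2 + eps)) C)| <= K / m%:R.
Proof.
move=> eps0 d3; have d0 : (0 < d)%N by apply: leq_trans d3.
pose M := (d.+1 ^ (48 * d))%N.
have M1 : (1 < M)%N by rewrite -[ltnLHS](exp1n (48 * d)) ltn_exp2r ?muln_gt0 ?d0 // ltnS.
have [D [C [m1 diam]]] := diameter_whp d3 M1.
have [m2 coll] := collapsing_whp eps0 d3.
exists (52 * D%:R ^+ 2), (1 + C%:R), (m1 + m2 + d.+1)%N => n m lem mn nd md.
have [lem1 lem2 dm] : [/\ m1 <= m, m2 <= m & d < m]%N.
  by clear -lem; split; lia.
have m0 : (0 < m)%N by apply: leq_trans dm.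
have mR : 0 < m%:R :> R by rewrite ltr0n.
set delta := _ `^ _; pose r := trunc_log M m.
have -> : (1 + C%:R) / m%:R = m%:R^-1 + C%:R / m%:R :> R by rewrite mulrDl mul1r.
have diam_m := diam 'I_m; rewrite card_ord in diam_m.
pose B' := [set H in reg_graphs 'I_m d |
  ~~ [forall x, forall y, y \in gball H x (D * r.+1)]].
pose bad H := if H \in reg_graphs 'I_m d then
  collapsing n d delta H r (edge_threshold n d) else finset.set0.
rewrite /prob_regular_pair; apply: (@uniform_pair_prob R _ _ (regular_graphs n d) (regular_graphs m d) B' _ bad).
- by apply: reg_graphs_gt0 => //; apply: leq_trans mn.
- exact: reg_graphs_gt0.
- by rewrite invr_ge0 ltW.
- rewrite mulrAC ler_pdivlMr // -!natrM ler_nat; exact: diam_m.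
- move=> H HR; rewrite /bad -[regular_graphs m d]/(reg_graphs 'I_m d) in HR *; rewrite HR.
  rewrite mulrC ler_pdivlMr // -natrM ler_nat.
  apply: leq_trans (coll n m H lem2 mn HR); rewrite leq_mul2l; apply/orP; right.
  by apply: leq_trans mn _; apply/ltnW/ltn_expl.
move=> G H GR HR; rewrite /bad -[regular_graphs m d]/(reg_graphs 'I_m d) in HR *; rewrite HR.
move=> ngood nB'; have {nB'} diamH x y : y \in gball H x (D * r.+1).
  by move: nB'; rewrite finset.in_set HR negbK => /forallP /(_ x) /forallP.
apply: contraR ngood => nG; apply/andP; split.
  apply/forallP => x; apply/forallP => y.
  by have /gballP[p [Hp <- _]] := diamH x y; apply/connectP; exists p.
apply/forallP => f; apply/implyP => small.
apply: (@stretched_gamma R n m d D r) => //.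
- exact: leq_trans mn.
- rewrite ltnNge; apply: contra nG => many.
  by rewrite finset.in_set GR; apply/existsP; exists f; rewrite small.
Qed.

Local Open Scope classical_set_scope.

Theorem theorem2 (R : realType) (eps : R) (d : nat) :
  0 < eps -> (3 <= d)%N ->
  exists C : R, forall m : nat -> nat,
    (forall n : nat, (m n <= n)%N) ->
    m n @[n --> \oo] --> \oo ->
    @prob_regular_pair R n (m n) d
      (good_pair d ((m n)%:R `^ (2^-1 + 2 / d%:R ^+ 2 + eps)) C)
      @[n --> within [set n | ~~ odd (n * d) /\ ~~ odd (m n * d)] \oo]
      --> (1 : R).
Proof.
move=> eps0 d3; have [C [K [m0 close]]] := good_pair_prob eps0 d3.
exists C => m mn moo; apply/cvgrPdist_le => e e0.
rewrite near_withinE.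
have mge A : \forall n \near \oo, (A <= m n)%N by move/cvgnyPge: moo; apply.
pose A := maxn m0 (Num.truncn (K / e)).+1.
near=> n; case=> nd md.
have Am : (A <= m n)%N by near: n; exact: mge.
apply: le_trans (close _ _ _ (mn n) nd md) _.
  by apply: leq_trans Am; apply: leq_maxl.
have m1 : (Num.truncn (K / e) < m n)%N by apply: leq_trans Am; apply: leq_maxr.
have mR : 0 < (m n)%:R :> R by rewrite ltr0n; apply: leq_trans m1.
rewrite ler_pdivrMr // mulrC -ler_pdivrMr //.
by apply/ltW/(lt_le_trans (truncnS_gt _)); rewrite ler_nat.
Unshelve. all: by end_near.
Qed.
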